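(* CFFA is solvable in time $O\big(2^{m}(n+m)^{O(1)}\big)$, where $m=|\mathcal{I}|$ is the number of jobs and $n=|\mathcal{A}|$ is the number of agents.
   Context: CFFA: the input is a finite set of agents $\mathcal{A}$, a finite set of jobs $\mathcal{I}$, for each agent $a\in\mathcal{A}$ a utility function $u_a\colon\mathcal{I}\to\mathbb{N}$, a positive integer $\eta$, and a graph $\mathcal{H}$ with vertex set $\mathcal{I}$. The question is whether there is $\phi\colon\mathcal{A}\to 2^{\mathcal{I}}$ such that each $\phi(a)$ is an independent set in $\mathcal{H}$ with $\sum_{x\in\phi(a)}u_a(x)\ge\eta$, and the sets $\phi(a)$, $a\in\mathcal{A}$, are pairwise disjoint. *)

(* Defs.v *)
From mathcomp Require Import all_boot.

Set Implicit Arguments.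
Unset Strict Implicit.
Unset Printing Implicit Defensive.

(** * Conflict-free fair allocation *)

(* The conflict graph is a finite simple undirected graph on the jobs. *)
Record cffa := Cffa {
  agent : finType;
  job : finType;
  utility : agent -> job -> nat;
  eta : nat;
  eta_gt0 : 0 < eta;
  conflict : rel job;
  conflict_sym : symmetric conflict;
  conflict_irr : irreflexive conflict
}.

Definition independent (V : finType) (e : rel V) (S : {set V}) : Prop :=
  forall x y : V, x \in S -> y \in S -> ~~ e x y.

Definition fair_allocation (X : cffa) (phi : agent X -> {set job X}) : Prop :=
  (forall a, independent (@conflict X) (phi a)) /\
  (forall a, eta X <= \sum_(x in phi a) utility a x) /\
  (forall a b, a != b -> [disjoint phi a & phi b]).

Definition yes_instance (X : cffa) : Prop :=
  exists phi : agent X -> {set job X}, fair_allocation phi.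

(** * Word RAM *)

(* A word RAM with word length [w]: registers and memory cells hold integers
   below [2 ^ w], arithmetic is modulo [2 ^ w], and memory is addressed by
   register contents.  A program is a finite list of instructions, so it uses
   only finitely many registers; jump targets are absolute positions in the
   list.  Every instruction takes one time step.  The word length is not part
   of the program. *)

Variant binop := OpAdd | OpSub | OpMul | OpDiv | OpMod.

Variant instr :=
| Const (r c : nat)               (* r := c *)
| Arith (o : binop) (r a b : nat) (* r := a o b *)
| LoadMem (r a : nat)             (* r := mem[a] *)
| StoreMem (a b : nat)            (* mem[a] := b *)
| Jump (l : nat)
| JumpLt (a b l : nat).           (* if a < b then goto l *)

Definition program := seq instr.

Record state := State { pc : nat; regs : nat -> nat; cells : nat -> nat }.

(* Division and remainder by zero follow [divn] and [modn]. *)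
Definition eval_binop (w : nat) (o : binop) (x y : nat) : nat :=
  match o with
  | OpAdd => (x + y) %% 2 ^ w
  | OpSub => (x + 2 ^ w - y) %% 2 ^ w
  | OpMul => (x * y) %% 2 ^ w
  | OpDiv => x %/ y
  | OpMod => x %% y
  end.

Definition exec (w : nat) (i : instr) (s : state) : state :=
  let: State p g h := s in
  match i with
  | Const r c => State p.+1 [eta g with r |-> c %% 2 ^ w] h
  | Arith o r a b => State p.+1 [eta g with r |-> eval_binop w o (g a) (g b)] h
  | LoadMem r a => State p.+1 [eta g with r |-> h (g a)] h
  | StoreMem a b => State p.+1 g [eta h with g a |-> g b]
  | Jump l => State l g h
  | JumpLt a b l => State (if g a < g b then l else p.+1) g h
  end.

(* The machine halts when the program counter leaves the program; a halted
   state is a fixed point of [step]. *)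
Definition halted (P : program) (s : state) : bool := size P <= pc s.

Definition step (w : nat) (P : program) (s : state) : state :=
  if onth P (pc s) is Some i then exec w i s else s.

(* The input occupies the first memory cells; all the rest is zero. *)
Definition init (input : seq nat) : state :=
  State 0 (fun=> 0) (fun i => nth 0 input i).

Definition run (w : nat) (P : program) (input : seq nat) (t : nat) : state :=
  iter t (step w P) (init input).

Definition accepting (s : state) : bool := regs s 0 != 0.

(** * Instances as inputs *)

(* One number per word: the numbers of agents and jobs, the threshold, the
   utility matrix and the adjacency matrix, both row by row. *)
Definition encode (X : cffa) : seq nat :=
  [:: #|agent X|; #|job X|; eta X] ++
  [seq utility a x | a <- enum (agent X), x <- enum (job X)] ++
  [seq nat_of_bool (conflict x y) | x <- enum (job X), y <- enum (job X)].

(* Number of binary digits of the largest input number. *)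
Definition input_bits (X : cffa) : nat :=
  \max_(k <- encode X) up_log 2 k.+1.

(* [P] decides every instance in at most [T n m] steps, [n] being the number of
   agents and [m] the number of jobs, on every word RAM whose words have at
   least [K] times as many bits as are needed to index the subsets of jobs and
   to hold an input number.  The size of the utilities enters the word length
   but not the number of steps.  A run always ends with the right answer; the
   bound on its length is asserted for [0 < n + m], since a bound such as
   [(n + m) ^ c] vanishes on the empty instance. *)
Definition decides_cffa (P : program) (K : nat) (T : nat -> nat -> nat) : Prop :=
  forall (X : cffa) (w : nat),
    let n := #|agent X| in
    let m := #|job X| in
    K * (m + input_bits X) <= w ->
    exists t : nat,
      [/\ halted P (run w P (encode X) t),
          accepting (run w P (encode X) t) <-> yes_instance X
        & 0 < n + m -> t <= T n m].

(* Main.v *)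
(** Dynamic programming over the agents: a set [T] of jobs is reachable after
    [a + 1] agents iff [T] is the disjoint union of a bundle acceptable to agent
    [a] and of a set reachable after [a] agents.  One such step costs
    [2 ^ m * m ^ O(1)]: a union of sets of sizes [j] and [k] is disjoint iff it has
    size [j + k], so for each pair [(j, k)] it suffices to know for which [T] of
    that size the union product of two indicator functions is nonzero.  The zeta
    transform turns union products into pointwise products, and both it and its
    Moebius inverse are computed in place, one bit at a time.  All numbers involved
    are at most [4 ^ m] because only the indicator of the reachable sets is passed
    from one agent to the next; they fit into one word. *)

Require Import Defs.
From mathcomp Require Import all_boot zify.

Set Implicit Arguments.
Unset Strict Implicit.
Unset Printing Implicit Defensive.

(** * A structured language and its compilation *)

(** The running time may not depend on the utilities, and correctness has to survive arithmetic
    modulo [2 ^ w]. The first is met by a loop language without conditionals: every test is an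
    arithmetic expression with value 0 or 1, and the only branching is in loops whose bounds are
    registers that the command never changes. The number of machine steps is then an exact function
    of the loop bounds, so halting, correctness and running time all follow from one simulation
    lemma. The second rests on two observations. Sums and products may wrap internally as long as
    the final value fits. And Moebius inversion, usually a signed sum, never meets a negative number
    here: undone one direction at a time, it passes only through partial zeta transforms of a
    nonnegative function, and all of these are bounded by the total of that function. *)

Inductive expr :=
| Var (r : nat)
| Cst (c : nat)
| Bin (o : binop) (e1 e2 : expr)
| Mem (e : expr).

Inductive cmd :=
| Asg (r : nat) (e : expr)
| Sto (e1 e2 : expr)
| Seq (c1 c2 : cmd)
| For (i b : nat) (c : cmd).

Record store := Store { rg : nat -> nat; mm : nat -> nat }.

Definition upd (f : nat -> nat) (r v : nat) : nat -> nat :=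
  fun x => if x == r then v else f x.

Definition setr (s : store) (r v : nat) : store := Store (upd (rg s) r v) (mm s).
Definition setm (s : store) (x v : nat) : store := Store (rg s) (upd (mm s) x v).

Fixpoint eval (w : nat) (s : store) (e : expr) : nat :=
  match e with
  | Var r => rg s r
  | Cst c => c %% 2 ^ w
  | Bin o e1 e2 => eval_binop w o (eval w s e1) (eval w s e2)
  | Mem e => mm s (eval w s e)
  end.

Definition incr (i : nat) : expr := Bin OpAdd (Var i) (Cst 1).

(* The loop variable runs through [0, ..., b - 1] and ends with the value [b]. *)
Fixpoint sem (w : nat) (c : cmd) (s : store) : store :=
  match c with
  | Asg r e => setr s r (eval w s e)
  | Sto e1 e2 => setm s (eval w s e1) (eval w s e2)
  | Seq c1 c2 => sem w c2 (sem w c1 s)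
  | For i b c =>
      iter (rg s b)
        (fun s => let s' := sem w c s in setr s' i (eval w s' (incr i)))
        (setr s i 0)
  end.

Fixpoint mods (c : cmd) (r : nat) : bool :=
  match c with
  | Asg r' _ => r == r'
  | Sto _ _ => false
  | Seq c1 c2 => mods c1 r || mods c2 r
  | For i _ c => (r == i) || mods c r
  end.

Fixpoint loop_bounds (c : cmd) : seq nat :=
  match c with
  | Seq c1 c2 => loop_bounds c1 ++ loop_bounds c2
  | For _ b c => b :: loop_bounds c
  | _ => [::]
  end.

(* Registers from [T0] on are reserved for the evaluation of expressions. *)
Notation T0 := 32.

Fixpoint wfe (e : expr) : bool :=
  match e with
  | Var r => r < T0
  | Cst _ => true
  | Bin _ e1 e2 => wfe e1 && wfe e2
  | Mem e => wfe e
  end.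

Fixpoint wf (c : cmd) : bool :=
  match c with
  | Asg r e => (r < T0) && wfe e
  | Sto e1 e2 => wfe e1 && wfe e2
  | Seq c1 c2 => wf c1 && wf c2
  | For i b c =>
      [&& i < T0, b < T0, i != b, ~~ mods c i, ~~ mods c b & wf c]
  end.

(* The machine has no move instruction; dividing by [1] copies a register. *)
Fixpoint cexpr (e : expr) (t : nat) : seq instr :=
  match e with
  | Var r => [:: Const t 1; Arith OpDiv t r t]
  | Cst c => [:: Const t c]
  | Bin o e1 e2 => cexpr e1 t ++ cexpr e2 t.+1 ++ [:: Arith o t t t.+1]
  | Mem e => cexpr e t ++ [:: LoadMem t t]
  end.

Definition casg (r : nat) (e : expr) : seq instr :=
  cexpr e T0 ++ [:: Const T0.+1 1; Arith OpDiv r T0 T0.+1].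

Definition csto (e1 e2 : expr) : seq instr :=
  cexpr e1 T0 ++ cexpr e2 T0.+1 ++ [:: StoreMem T0 T0.+1].

(** Jump targets are absolute, so the length of a loop must be known before its code is laid out.
    The 12 consists of 3 instructions clearing the counter, 2 for the test, 6 for the increment and
    1 for the jump back. *)
Fixpoint csize (c : cmd) : nat :=
  match c with
  | Asg r e => size (casg r e)
  | Sto e1 e2 => size (csto e1 e2)
  | Seq c1 c2 => csize c1 + csize c2
  | For i b c => csize c + 12
  end.

Fixpoint ccmd (p : nat) (c : cmd) : seq instr :=
  match c with
  | Asg r e => casg r e
  | Sto e1 e2 => csto e1 e2
  | Seq c1 c2 => ccmd p c1 ++ ccmd (p + csize c1) c2
  | For i b c =>
      casg i (Cst 0) ++ [:: JumpLt i b (p + 5); Jump (p + (csize c + 12))] ++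
      ccmd (p + 5) c ++ casg i (incr i) ++ [:: Jump (p + 3)]
  end.

(** Each round adds to its body the successful test, 6 instructions for the increment and the jump
    back. The 5 pays for clearing the counter, the failing test and the exit jump. *)
Fixpoint cost (N : nat -> nat) (c : cmd) : nat :=
  match c with
  | Asg r e => size (casg r e)
  | Sto e1 e2 => size (csto e1 e2)
  | Seq c1 c2 => cost N c1 + cost N c2
  | For i b c => N b * (cost N c + 8) + 5
  end.

Lemma size_ccmd p c : size (ccmd p c) = csize c.
Proof.
elim: c p => [r e|e1 e2|c1 IH1 c2 IH2|i b c IH] p //=.
  by rewrite size_cat IH1 IH2.
by rewrite size_cat /= IH; lia.
Qed.

Lemma sem_frame w c s r : ~~ mods c r -> rg (sem w c s) r = rg s r.
Proof.
elim: c s => [r' e|e1 e2|c1 IH1 c2 IH2|i b c IH] s //=.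
- by rewrite /upd => /negbTE->.
- by case/norP => h1 h2; rewrite IH2 // IH1.
case/norP => /negbTE ri h2.
elim: (rg s b) => [|k IHk] /=; first by rewrite /upd ri.
by rewrite /upd ri IH.
Qed.

(** The step premise also supplies the counter value and the registers that the body leaves alone,
    so an invariant need only mention what changes. The bound on [rg s b] keeps the counter from
    wrapping. *)
Lemma for_rule w i b c s (I : nat -> store -> Prop) :
  ~~ mods c i -> ~~ mods c b -> i != b -> rg s b < 2 ^ w ->
  I 0 (setr s i 0) ->
  (forall k s', k < rg s b -> rg s' i = k ->
    (forall r, r != i -> ~~ mods c r -> rg s' r = rg s r) ->
    I k s' -> I k.+1 (setr (sem w c s') i k.+1)) ->
  I (rg s b) (sem w (For i b c) s).
Proof.
move=> ci cb ib bW I0 IS /=.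
set f := fun _ => _.
suff H k : k <= rg s b ->
    [/\ I k (iter k f (setr s i 0)), rg (iter k f (setr s i 0)) i = k
      & forall r, r != i -> ~~ mods c r ->
          rg (iter k f (setr s i 0)) r = rg s r].
  by case: (H _ (leqnn _)).
elim: k => [|k IHk] lek.
  split=> //; first by rewrite /= /upd eqxx.
  by move=> r /negbTE ri _; rewrite /= /upd ri.
case: (IHk (ltnW lek)) => Ik ik fr; rewrite iterS.
set sk := iter k f _ in Ik ik fr *.
have -> : f sk = setr (sem w c sk) i k.+1.
  rewrite {1}/f /= sem_frame ?ik ?modnDmr ?addn1 ?modn_small //.
  exact: leq_ltn_trans lek bW.
split.
- exact: IS.
- by rewrite /= /upd eqxx.
- by move=> r ri cr; rewrite /= /upd (negbTE ri) sem_frame // fr.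
Qed.

(** * Simulation of the structured language on the word RAM *)

Definition code_at (P : program) (p : nat) (l : seq instr) : Prop :=
  forall k, k < size l -> onth P (p + k) = onth l k.

Lemma code_at_cat P p l1 l2 :
  code_at P p (l1 ++ l2) -> code_at P p l1 /\ code_at P (p + size l1) l2.
Proof.
move=> h; split=> k kl.
  by rewrite h ?size_cat; [rewrite onth_cat kl|lia].
by rewrite -addnA h ?size_cat; [rewrite onth_cat ltnNge leq_addr addKn|lia].
Qed.

Lemma code_at_step w P p l i st :
  code_at P p (i :: l) -> pc st = p -> step w P st = exec w i st.
Proof. by move=> h pcE; rewrite /step pcE -[p]addn0 h. Qed.

Definition flat (i : instr) : bool :=
  match i with Jump _ | JumpLt _ _ _ => false | _ => true end.

Definition exec_seq (w : nat) (l : seq instr) (st : state) : state :=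
  foldl (fun st i => exec w i st) st l.

Lemma exec_seq_cat w l1 l2 st :
  exec_seq w (l1 ++ l2) st = exec_seq w l2 (exec_seq w l1 st).
Proof. exact: foldl_cat. Qed.

Lemma exec_seq_rcons w l i st :
  exec_seq w (l ++ [:: i]) st = exec w i (exec_seq w l st).
Proof. by rewrite exec_seq_cat. Qed.

Lemma pc_exec_seq w l st : all flat l -> pc (exec_seq w l st) = pc st + size l.
Proof.
elim: l st => [|i l IH] st /=; first by rewrite addn0.
by case/andP=> fi fl; rewrite IH //; case: i fi {IH} => //=; case: st => *; rewrite /= addSnnS.
Qed.

Lemma iter_exec_seq w P l st :
  all flat l -> code_at P (pc st) l -> iter (size l) (step w P) st = exec_seq w l st.
Proof.
elim: l st => [|i l IH] st //= /andP[fi fl] h.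
rewrite -iterS iterSr (@code_at_step w P (pc st) l i) // IH //.
move=> k kl; have /= <- := h k.+1 kl; rewrite -addSnnS; congr (onth P (_ + _)).
by case: i fi {h} => //; case: st.
Qed.

Lemma flat_cexpr e t : all flat (cexpr e t).
Proof.
elim: e t => [r|c|o e1 IH1 e2 IH2|e IH] t //=; rewrite !all_cat ?IH1 ?IH2 ?IH //.
Qed.

Lemma flat_casg r e : all flat (casg r e).
Proof. by rewrite all_cat flat_cexpr. Qed.

Lemma flat_csto e1 e2 : all flat (csto e1 e2).
Proof. by rewrite !all_cat !flat_cexpr. Qed.

Definition agree (s : store) (st : state) : Prop :=
  (forall r, r < T0 -> regs st r = rg s r) /\ (forall x, cells st x = mm s x).

(** Scratch registers are used as a stack with top [t]: preservation of everything below [t] lets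
    the first operand survive the evaluation of the second one at [t.+1]. The word length must be
    positive because copying divides by the constant 1, which would be 0 modulo [2 ^ 0]. *)
Lemma cexpr_ok w s e t st : 0 < w -> wfe e -> T0 <= t -> agree s st ->
  [/\ regs (exec_seq w (cexpr e t) st) t = eval w s e,
      forall r, r < t -> regs (exec_seq w (cexpr e t) st) r = regs st r
    & cells (exec_seq w (cexpr e t) st) = cells st].
Proof.
move=> w0; elim: e t st => [r|c|o e1 IH1 e2 IH2|e IH] t st /=.
- case: st => p g h rT tT [ag _].
  have one : 1 %% 2 ^ w = 1 by rewrite modn_small // -{1}(expn0 2) ltn_exp2l.
  split=> //=; last by move=> r' r't; rewrite !ifN //; lia.
  rewrite eqxx -(ag r rT) /= ifN; last by lia.
  by rewrite one divn1.
- case: st => p g h _ tT ag; split=> //=; first by rewrite eqxx.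
  by move=> r' r't; rewrite ifN //; lia.
- case/andP=> w1 w2 tT ag; rewrite !exec_seq_cat.
  set st1 := exec_seq w (cexpr e1 t) st.
  have [v1 f1 c1] := IH1 t st w1 tT ag; rewrite -/st1 in v1 f1 c1.
  have ag1 : agree s st1.
    case: ag => ag cg; split=> [r rT|x]; last by rewrite c1.
    by rewrite f1 ?ag //; lia.
  set st2 := exec_seq w (cexpr e2 t.+1) st1.
  have [v2 f2 c2] := IH2 t.+1 st1 w2 (leqW tT) ag1; rewrite -/st2 in v2 f2 c2.
  rewrite /exec_seq /= -/(exec_seq w (cexpr e2 t.+1) st1) -/st2.
  case: st2 v2 f2 c2 => p g h /= v2 f2 c2; rewrite eqxx; split.
  + by rewrite v2 f2 // v1.
  + by move=> r rt; rewrite ifN ?f2 ?f1 //; lia.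
  + by rewrite c2.
- move=> we tT ag; rewrite exec_seq_rcons.
  have [v f c] := IH t st we tT ag.
  case: (exec_seq _ _ _) v f c => p g h /= v f c; rewrite eqxx; split=> //.
  + by rewrite v c; case: ag => _ ->.
  + by move=> r rt; rewrite ifN ?f //; lia.
Qed.

Lemma casg_ok w s r e st : 0 < w -> wfe e -> r < T0 -> agree s st ->
  agree (setr s r (eval w s e)) (exec_seq w (casg r e) st).
Proof.
move=> w0 we rT ag; rewrite /casg exec_seq_cat -[[:: _; _]]/([:: _] ++ [:: _]) !exec_seq_rcons.
have [v f c] := cexpr_ok w0 we (leqnn _) ag.
have one : 1 %% 2 ^ w = 1 by rewrite modn_small // -{1}(expn0 2) ltn_exp2l.
case: (exec_seq _ _ _) v f c => p g h /= v f c.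
case: ag => ag cg; split=> [r' r'T|x] /=; last by rewrite c cg.
rewrite /upd; case: eqP => [_|/eqP r'r]; first by rewrite one divn1.
by rewrite ifN ?f ?ag //; lia.
Qed.

Lemma csto_ok w s e1 e2 st : 0 < w -> wfe e1 -> wfe e2 -> agree s st ->
  agree (setm s (eval w s e1) (eval w s e2)) (exec_seq w (csto e1 e2) st).
Proof.
move=> w0 we1 we2 ag; rewrite /csto catA exec_seq_rcons exec_seq_cat.
have [v1 f1 c1] := cexpr_ok w0 we1 (leqnn _) ag.
set st1 := exec_seq w (cexpr e1 T0) st in v1 f1 c1 *.
have ag1 : agree s st1.
  by case: ag => ag cg; split=> [r rT|x]; rewrite ?c1 ?f1 ?ag.
have [v2 f2 c2] := cexpr_ok w0 we2 (leqnSn _) ag1.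
case: (exec_seq _ _ _) v2 f2 c2 => p g h /= v2 f2 c2.
case: ag1 => ag1 cg1; split=> [r rT|x] /=; first by rewrite f2 ?ag1 // ltnS ltnW.
by rewrite f2 // v1 v2 /upd c2 cg1.
Qed.

(** The whole command, not just the loop body, must leave its bounds alone. An inner loop then runs
    equally often in every round of an outer one, and the step count depends on [N] only. *)
Definition fixed_bounds (w : nat) (N : nat -> nat) (c : cmd) (s : store) : Prop :=
  forall b, b \in loop_bounds c -> [/\ rg s b = N b, ~~ mods c b & N b < 2 ^ w].

Lemma ccmd_ok w N P c p s st : 0 < w -> wf c -> fixed_bounds w N c s ->
  code_at P p (ccmd p c) -> pc st = p -> agree s st ->
  agree (sem w c s) (iter (cost N c) (step w P) st) /\
  pc (iter (cost N c) (step w P) st) = p + csize c.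
Proof.
move=> w0; elim: c p s st => [r e|e1 e2|c1 IH1 c2 IH2|i b c IH] p s st /=.
- case/andP=> rT we _ cd pcE ag; rewrite iter_exec_seq ?pcE ?flat_casg //.
  by rewrite pc_exec_seq ?flat_casg // pcE; split=> //; exact: casg_ok.
- case/andP=> we1 we2 _ cd pcE ag; rewrite iter_exec_seq ?pcE ?flat_csto //.
  by rewrite pc_exec_seq ?flat_csto // pcE; split=> //; exact: csto_ok.
- case/andP=> wf1 wf2 fx /code_at_cat[cd1 cd2] pcE ag.
  rewrite size_ccmd in cd2; rewrite addnC iterD.
  have fx1 : fixed_bounds w N c1 s.
    move=> b hb; have /= := fx b; rewrite mem_cat hb => /(_ isT)[-> + ->].
    by case/norP.
  have fx2 : fixed_bounds w N c2 (sem w c1 s).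
    move=> b hb; have /= := fx b; rewrite mem_cat hb orbT => /(_ isT)[hN + ->].
    by case/norP=> h1 h2; rewrite sem_frame.
  have [ag1 pc1] := IH1 _ _ _ wf1 fx1 cd1 pcE ag.
  by rewrite addnA; exact: IH2.
case/and5P=> iT bT ib ci /andP[cb wfc] fx cd pcE ag.
have [sb _ bW] : [/\ rg s b = N b, ~~ mods (For i b c) b & N b < 2 ^ w].
  by apply: fx; rewrite inE eqxx.
have {}cd : code_at P p (casg i (Cst 0) ++
    ([:: JumpLt i b (p + 5); Jump (p + (csize c + 12))] ++
    (ccmd (p + 5) c ++ (casg i (incr i) ++ [:: Jump (p + 3)])))) by [].
have [cdi {}cd] := code_at_cat cd.
have [cdj {}cd] := code_at_cat cd.
have [cdb {}cd] := code_at_cat cd.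
have [cdinc cdjmp] := code_at_cat cd.
rewrite size_ccmd -!addnA in cdinc cdjmp; rewrite -addnA in cdb.
set f := fun _ => _.
set st0 := exec_seq w (casg i (Cst 0)) st.
have init0 : agree (setr s i 0) st0 /\ pc st0 = p + 3.
  rewrite pc_exec_seq ?flat_casg // pcE; split=> //.
  have -> : 0 = eval w s (Cst 0) by rewrite /= mod0n.
  exact: casg_ok.
have E0 : iter 3 (step w P) st = st0.
  by rewrite /st0 -(@iter_exec_seq w P) ?flat_casg ?pcE.
(* After [k] rounds the machine is back at the loop test, at position [p + 3]. *)
have inv k : k <= N b ->
    [/\ agree (iter k f (setr s i 0))
          (iter (k * (cost N c + 8)) (step w P) st0),
        pc (iter (k * (cost N c + 8)) (step w P) st0) = p + 3,
        rg (iter k f (setr s i 0)) i = k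
      & forall r, r != i -> ~~ mods c r ->
          rg (iter k f (setr s i 0)) r = rg s r].
  elim: k => [|k IHk] lek.
    case: init0 => ag0 pc0; split=> //=; first by rewrite /upd eqxx.
    by move=> r /negbTE ri _; rewrite /= /upd ri.
  have [agk pck ik fr] := IHk (ltnW lek).
  rewrite mulSn iterD iterS.
  set stk := iter (k * _) _ _ in agk pck *.
  set sk := iter k f _ in agk ik fr *.
  have step1 : step w P stk = State (p + 5) (regs stk) (cells stk).
    rewrite (code_at_step _ cdj pck); case: (stk) agk => pk gk hk [/= agk _] /=.
    by rewrite !agk // ik fr 1?eq_sym // sb lek.
  have fxk : fixed_bounds w N c sk.
    move=> b' hb'; have /= := fx b'; rewrite inE hb' orbT => /(_ isT)[hN + ->].
    by case/norP=> h1 h2; rewrite fr.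
  have [agc pcc] := IH (p + 5) sk (State (p + 5) (regs stk) (cells stk))
    wfc fxk cdb erefl agk.
  have -> : cost N c + 8 = 1 + (6 + (cost N c + 1)) by lia.
  rewrite iterD iterD iterD [iter 1 _ stk]/= step1.
  set stc := iter (cost N c) _ _ in agc pcc *.
  have cdinc' : code_at P (pc stc) (casg i (incr i)).
    by rewrite pcc -addnA.
  have -> : iter 6 (step w P) stc = exec_seq w (casg i (incr i)) stc.
    by rewrite -(@iter_exec_seq w P) ?flat_casg.
  have agi : agree (f sk) (exec_seq w (casg i (incr i)) stc).
    by apply: casg_ok => //=; rewrite iT.
  set sti := exec_seq _ _ _ in agi *.
  have pci : pc sti = p + (11 + csize c).
    by rewrite pc_exec_seq ?flat_casg // pcc /=; lia.
  have stepj : step w P sti = State (p + 3) (regs sti) (cells sti).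
    rewrite (@code_at_step w P (p + (11 + csize c)) [::] (Jump (p + 3))) //.
      by case: (sti).
    by have <- : p + (3 + (2 + (csize c + 6))) = p + (11 + csize c) by lia.
  rewrite [iter 1 _ sti]/= stepj; split=> //.
    rewrite /f /= /upd eqxx sem_frame // ik modnDmr addn1 modn_small //.
    exact: leq_ltn_trans lek bW.
  by move=> r ri cr; rewrite /f /= /upd (negbTE ri) sem_frame // fr.
have [agN pcN iN _] := inv _ (leqnn _).
have -> : N b * (cost N c + 8) + 5 = 1 + (1 + (N b * (cost N c + 8) + 3)) by lia.
rewrite iterD iterD iterD E0 [iter 1 _ (iter _ _ _)]/=.
set stN := iter (N b * _) _ _ in agN pcN *.
have step1 : step w P stN = State (p + 4) (regs stN) (cells stN).
  rewrite (code_at_step _ cdj pcN); case: (stN) agN pcN => pk gk hk [/= agk _] /= ->.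
  have [_ _ _ fr] := inv _ (leqnn _).
  by rewrite !agk // iN fr 1?eq_sym // sb ltnn -addnS.
have step2 : step w P (step w P stN) = State (p + (csize c + 12)) (regs stN) (cells stN).
  rewrite step1.
  have [_ cdj2] : code_at P (p + 3) [:: JumpLt i b (p + 5)] /\
      code_at P (p + 3 + 1) [:: Jump (p + (csize c + 12))].
    exact: (@code_at_cat P (p + 3) [:: _]).
  by rewrite (code_at_step _ cdj2) // -addnA.
by rewrite step2 sb.
Qed.

(** * Bit masks *)

Definition bit (b Y : nat) : nat := (Y %/ 2 ^ b) %% 2.

Lemma bit_lt2 b Y : bit b Y < 2.
Proof. exact: ltn_pmod. Qed.

Lemma bit_bool b Y : bit b Y = (bit b Y == 1).
Proof. by case: (bit b Y) (bit_lt2 b Y) => [|[]]. Qed.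

Lemma bit0 Y : bit 0 Y = Y %% 2.
Proof. by rewrite /bit divn1. Qed.

Lemma bitS b Y : bit b.+1 Y = bit b (Y %/ 2).
Proof. by rewrite /bit expnS divnMA. Qed.

Lemma bit_inj m Y Z : Y < 2 ^ m -> Z < 2 ^ m ->
  (forall b, b < m -> bit b Y = bit b Z) -> Y = Z.
Proof.
elim: m Y Z => [|m IH] Y Z; first by rewrite expn0 !ltnS !leqn0 => /eqP-> /eqP->.
rewrite expnS => Ym Zm h.
have h0 : Y %% 2 = Z %% 2 by have := h 0 isT; rewrite !bit0.
suff h1 : Y %/ 2 = Z %/ 2 by rewrite (divn_eq Y 2) (divn_eq Z 2) h0 h1.
by apply: IH => [||b bm]; rewrite ?ltn_divLR ?[_ * 2]mulnC // -!bitS h.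
Qed.

Lemma bit_leq b Y : bit b Y = 1 -> 2 ^ b <= Y.
Proof. by rewrite leqNgt /bit => h; apply/negP => /divn_small Y0; rewrite Y0 in h. Qed.

Lemma bit_sub b c Y : bit b Y = 1 ->
  bit c (Y - 2 ^ b) = if c == b then 0 else bit c Y.
Proof.
elim: b c Y => [|b IH] c Y hb.
  rewrite expn0; rewrite bit0 in hb.
  case: c => [|c]; first by rewrite bit0 /=; lia.
  by rewrite !bitS /=; congr bit; lia.
have le := bit_leq hb; rewrite expnS in le *; rewrite bitS in hb.
case: c => [|c]; first by rewrite !bit0 /=; lia.
by rewrite !bitS eqSS -IH //; congr bit; lia.
Qed.

Section Masks.
Variable J : finType.
Local Notation m := #|J|.

Definition mset (Y : nat) : {set J} := [set x | bit (enum_rank x) Y == 1].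

Lemma bit_mset (i : 'I_m) Y : bit i Y = (enum_val i \in mset Y).
Proof. by rewrite inE enum_valK -bit_bool. Qed.

Lemma mset_inj Y Z : Y < 2 ^ m -> Z < 2 ^ m -> mset Y = mset Z -> Y = Z.
Proof.
move=> Ym Zm E; apply: (bit_inj Ym Zm) => b bm.
by have := bit_mset (Ordinal bm) Y; rewrite E -bit_mset.
Qed.

Lemma card_sets : #|{set J}| = 2 ^ m.
Proof. by rewrite -[in RHS]cardsT -card_powerset powersetT cardsT. Qed.

Lemma mset_surj S : exists2 Y, Y < 2 ^ m & mset Y = S.
Proof.
pose f (i : 'I_(2 ^ m)) := mset i.
have fI : injective f by move=> i j /mset_inj h; apply/val_inj/h.
have : S \in codom f.
  by rewrite (inj_card_onto fI) // card_ord card_sets.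
by case/codomP => i ->; exists i.
Qed.

Lemma mset0 : mset 0 = set0.
Proof. by apply/setP=> x; rewrite !inE /bit div0n mod0n. Qed.

Lemma mset_sub (i : 'I_m) Y : bit i Y = 1 ->
  mset (Y - 2 ^ i) = mset Y :\ enum_val i.
Proof.
move=> h; apply/setP=> x; rewrite !inE bit_sub //.
have -> : (enum_rank x == i :> nat) = (x == enum_val i).
  by rewrite (inj_eq val_inj) (can2_eq enum_rankK enum_valK).
by case: (x == _).
Qed.

Lemma sum_mset (F : J -> nat) (g : nat -> nat) Y :
  (forall x, g (enum_rank x) = F x) ->
  \sum_(i < m) bit i Y * g i = \sum_(x in mset Y) F x.
Proof.
move=> gF; rewrite (reindex enum_rank) /=; last first.
  by exists enum_val => x _; rewrite ?enum_rankK ?enum_valK.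
rewrite [RHS]big_mkcond; apply: eq_bigr => x _.
by rewrite bit_mset enum_rankK gF; case: (_ \in _); rewrite ?mul1n.
Qed.

(** * Zeta transform and union product *)

(* The zeta transform of [f] in the directions [P] only. *)
Definition zeta (P : {set J}) (f : {set J} -> nat) (Y : {set J}) : nat :=
  \sum_(S : {set J} | (S \subset Y) && (Y :\: S \subset P)) f S.

Lemma zeta0 f Y : zeta set0 f Y = f Y.
Proof.
rewrite /zeta (big_pred1 Y) // => S /=.
by rewrite subset0 setD_eq0 -eqEsubset.
Qed.

Lemma zetaT f Y : zeta setT f Y = \sum_(S : {set J} | S \subset Y) f S.
Proof. by apply: eq_bigl => S; rewrite subsetT andbT. Qed.

(** Split the sets [S] by whether they contain [x]. Those that do differ from [Y] only in directions
    of [P]. Those that do not are exactly the sets counted for [Y :\ x], and they contribute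
    something new only if [x] is in [Y]. *)
Lemma zetaU1 (x : J) (P : {set J}) f Y : x \notin P ->
  zeta (x |: P) f Y = zeta P f Y + (x \in Y) * zeta P f (Y :\ x).
Proof.
move=> xP; have [xY|xY] := boolP (x \in Y); last first.
  rewrite addn0; apply: eq_bigl => S; congr (_ && _).
  apply/subsetP/subsetP => h y yYS; last by rewrite !inE h ?orbT.
  move: (h y yYS); rewrite !inE; case: eqP => // yx _.
  by rewrite yx inE (negbTE xY) andbF in yYS.
rewrite mul1n {1}/zeta (bigID (fun S : {set J} => x \in S)) /=; congr (_ + _).
  apply: eq_bigl => S; rewrite !subDset -andbA; congr (_ && _).
  apply/andP/idP => [[h xS]|h].
    have E : x |: S = S by apply/setUidPr; rewrite sub1set.
    by move: h; rewrite setUCA setUA E.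
  split; first by apply: subset_trans h _; rewrite setUS ?subsetUr.
  by have := subsetP h x xY; rewrite inE (negbTE xP) orbF.
by apply: eq_bigl => S; rewrite !subDset subsetD1 setUCA andbAC.
Qed.

(* For [A] and [B] supported on sets of sizes [j] and [k], the values at the
   sets of size [j + k] form the subset convolution. *)
Definition uprod (A B : {set J} -> nat) (T : {set J}) : nat :=
  \sum_(S : {set J}) \sum_(S' : {set J}) (S :|: S' == T) * (A S * B S').

(** Each pair [S], [S'] is counted at the single set [T = S :|: S'], and a union lies in [Y] iff
    both parts do, so the double sum factors. *)
Lemma zetaT_uprod A B Y :
  zeta setT (uprod A B) Y = zeta setT A Y * zeta setT B Y.
Proof.
rewrite !zetaT /uprod exchange_big /= [X in X * _]big_mkcond big_distrl /=.
apply: eq_bigr => S _; rewrite exchange_big /= [X in _ * X]big_mkcond big_distrr.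
apply: eq_bigr => S' _ /=; rewrite -big_distrl /=.
have -> : \sum_(T : {set J} | T \subset Y) (S :|: S' == T) = (S :|: S' \subset Y).
  rewrite big_mkcond (bigD1 (S :|: S')) //= eqxx big1 ?addn0; first by case: ifP.
  by move=> T /negbTE TS; rewrite eq_sym TS; case: ifP.
by rewrite subUset; do 2!case: (_ \subset _); rewrite ?mul1n ?muln0.
Qed.

(** Since [f] is nonnegative, one bound on its total covers every intermediate stage of both
    transforms. *)
Lemma zeta_leT P f Y : zeta P f Y <= zeta setT f setT.
Proof.
rewrite /zeta [leqRHS](bigID (fun S : {set J} => (S \subset Y) && (Y :\: S \subset P))) /=.
apply: leq_trans (leq_addr _ _); rewrite leq_eqVlt; apply/orP; left; apply/eqP.
by apply: eq_bigl => S; rewrite !subsetT.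
Qed.

Lemma zeta_indicator P (p : {set J} -> bool) Y :
  zeta P (fun S => p S : nat) Y <= 2 ^ m.
Proof.
apply: leq_trans (zeta_leT _ _ _) _; rewrite zetaT.
rewrite -card_sets -sum1_card [leqLHS]big_mkcond.
by apply: leq_sum => S _; rewrite subsetT leq_b1.
Qed.

(** After [b] rounds the zeta transform has treated exactly these directions, while the Moebius
    transform has exactly the complementary ones left to undo. *)
Definition bits_below (b : nat) : {set J} := [set x | enum_rank x < b].

Lemma bits_below0 : bits_below 0 = set0.
Proof. by apply/setP=> x; rewrite !inE. Qed.

Lemma bits_belowT : bits_below m = setT.
Proof. by apply/setP=> x; rewrite !inE ltn_ord. Qed.

Lemma bits_belowS (i : 'I_m) : bits_below i.+1 = enum_val i |: bits_below i.
Proof.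
apply/setP=> x; rewrite !inE ltnS leq_eqVlt; congr (_ || _).
by rewrite (inj_eq val_inj) (can2_eq enum_rankK enum_valK).
Qed.

Lemma bits_below_notin (i : 'I_m) : enum_val i \notin bits_below i.
Proof. by rewrite inE enum_valK ltnn. Qed.

(** The factor [bit i Y] replaces the case distinction on the bit, which is the branch-free form
    that the program evaluates. *)
Lemma zeta_step (i : 'I_m) f Y :
  zeta (bits_below i.+1) f (mset Y) =
  zeta (bits_below i) f (mset Y) +
  bit i Y * zeta (bits_below i) f (mset (Y - bit i Y * 2 ^ i)).
Proof.
rewrite bits_belowS zetaU1 ?bits_below_notin // -bit_mset.
have [h|->] : bit i Y = 1 \/ bit i Y = 0; last by rewrite !mul0n.
  by case: (bit i Y) (bit_lt2 i Y) => [|[]]; auto.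
by rewrite h !mul1n mset_sub.
Qed.

(** Stated as an addition: solved for the first summand on the right it is one round of Moebius
    inversion, and it shows at once that the subtrahend never exceeds the minuend. *)
Lemma moebius_step (i : 'I_m) f Y :
  zeta (~: bits_below i) f (mset Y) =
  zeta (~: bits_below i.+1) f (mset Y) +
  bit i Y * zeta (~: bits_below i) f (mset (Y - bit i Y * 2 ^ i)).
Proof.
have bE : ~: bits_below i = enum_val i |: ~: bits_below i.+1.
  rewrite bits_belowS; apply/setP=> x; rewrite !inE negb_or.
  by case: eqP => [->|//]; rewrite enum_valK ltnn.
have ni : enum_val i \notin ~: bits_below i.+1.
  by rewrite bits_belowS !inE eqxx.
have [h|h] : bit i Y = 1 \/ bit i Y = 0.
- by case: (bit i Y) (bit_lt2 i Y) => [|[]]; auto.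
- rewrite h !mul1n mset_sub // bE !zetaU1 // -bit_mset h mul1n.
  by rewrite [in RHS]inE in_set1 eqxx mul0n addn0.
by rewrite h mul0n bE zetaU1 // -bit_mset h.
Qed.

(** * Unions of pairwise disjoint good sets *)

Section Reach.
Variable good : nat -> {set J} -> bool.

Fixpoint reach (a : nat) (T : {set J}) : bool :=
  if a is b.+1 then
    [exists S : {set J}, exists S' : {set J},
      [&& S :|: S' == T, [disjoint S & S'], good b S & reach b S']]
  else T == set0.

Definition good_of_size a j (S : {set J}) : nat := good a S && (#|S| == j).
Definition reach_of_size a k (S : {set J}) : nat := reach a S && (#|S| == k).

Definition hits a j k (T : {set J}) : nat :=
  (#|T| == j + k) * uprod (good_of_size a j) (reach_of_size a k) T.

Lemma disjoint_cardU (S S' : {set J}) :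
  [disjoint S & S'] = (#|S :|: S'| == #|S| + #|S'|).
Proof.
by rewrite -setI_eq0 -cards_eq0; have := cardsUI S S'; lia.
Qed.

(** The products count pairs of sets. As nothing can cancel among natural numbers, testing the sum
    for zero loses no information about existence. *)
Lemma reachS a T :
  reach a.+1 T = (\sum_(j < m.+1) \sum_(k < m.+1) hits a j k T != 0).
Proof.
rewrite /= sum_nat_eq0 negb_forall; apply/idP/existsP.
  case/existsP=> S /existsP[S' /and4P[/eqP ST dj gS rS']].
  have cm (U : {set J}) : #|U| < m.+1 by rewrite ltnS max_card.
  exists (Ordinal (cm S)); rewrite /= sum_nat_eq0 negb_forall; apply/existsP.
  exists (Ordinal (cm S')); rewrite /= /hits -ST -disjoint_cardU dj mul1n.
  rewrite sum_nat_eq0 negb_forall; apply/existsP; exists S.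
  rewrite /= sum_nat_eq0 negb_forall; apply/existsP; exists S'.
  by rewrite /= eqxx /good_of_size /reach_of_size gS rS' !eqxx.
case=> j; rewrite /= sum_nat_eq0 negb_forall => /existsP[k] /=.
rewrite muln_eq0 negb_or eqb0 negbK => /andP[/eqP Tjk].
rewrite sum_nat_eq0 negb_forall => /existsP[S] /=.
rewrite sum_nat_eq0 negb_forall => /existsP[S'] /=.
rewrite !muln_eq0 !negb_or !eqb0 !negbK.
case/and3P=> /eqP ST /andP[gS /eqP Sj] /andP[rS' /eqP Sk].
apply/existsP; exists S; apply/existsP; exists S'.
by rewrite disjoint_cardU ST eqxx gS rS' Tjk Sj Sk eqxx.
Qed.

(** Indexing the family by natural numbers rather than by ['I_a] lets the induction extend it by
    overriding one value. *)
Lemma reachP a T : reach a T <-> exists phi : nat -> {set J},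
  [/\ forall i, i < a -> good i (phi i),
      forall i j, i < j < a -> [disjoint phi i & phi j]
    & T = \bigcup_(i < a) phi i].
Proof.
elim: a T => [|a IH] T /=.
  split=> [/eqP->|[phi [_ _ ->]]]; last by rewrite big_ord0.
  by exists (fun=> set0); rewrite big_ord0; split=> // i j /andP[].
split.
  case/existsP=> S /existsP[S' /and4P[/eqP<- dj gS /IH[phi [gp dp S'E]]]].
  exists (fun i => if i == a then S else phi i); split.
  - move=> i; rewrite ltnS leq_eqVlt; case: eqP => [-> _|_ /=]; first exact: gS.
    exact: gp.
  - move=> i j /andP[ij ja]; rewrite (ltn_eqF (leq_trans ij ja)).
    case: eqP => [_|/eqP jNa]; last by apply: dp; rewrite ij ltn_neqAle jNa.
    have ia : i < a by apply: leq_trans ij ja.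
    rewrite disjoint_sym; apply: disjointWr dj; rewrite S'E.
    exact: (@bigcup_sup _ _ (Ordinal ia) xpredT (fun i : 'I_a => phi i)).
  - rewrite big_ord_recr /= eqxx setUC S'E; congr (_ :|: _).
    by apply: eq_bigr => i _; rewrite ltn_eqF.
case=> phi [gp dp TE]; apply/existsP; exists (phi a); apply/existsP.
exists (\bigcup_(i < a) phi i); rewrite TE big_ord_recr /= setUC eqxx gp //=.
apply/andP; split; last first.
  apply/IH; exists phi; split=> // i; first by move=> ia; apply/gp/ltnW.
  by move=> j /andP[ij ja]; apply: dp; rewrite ij ltnW.
rewrite bigcup_disjoint // => i _; rewrite disjoint_sym.
by apply: dp; rewrite ltn_ord /=.
Qed.
End Reach.

End Masks.

Local Notation "x +' y" := (Bin OpAdd x y) (at level 50, left associativity).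
Local Notation "x -' y" := (Bin OpSub x y) (at level 50, left associativity).
Local Notation "x *' y" := (Bin OpMul x y) (at level 40, left associativity).
Local Notation "c1 ;; c2" := (Seq c1 c2) (at level 80, right associativity).

(* Memory holds the input, then two work arrays of [2 ^ m] cells at [r_A] and
   [r_B], then for each number of agents the indicator of the reachable sets, the
   current one at [r_F] and the next one at [r_G].  Register [r_ut] points to the
   utilities of the current agent and [r_adj] to the conflict matrix; [r_px],
   [r_py] and [r_pb] hold the powers of two of the current bits. *)
Local Notation r_res := 0 (only parsing).
Local Notation r_n := 1 (only parsing).
Local Notation r_m := 2 (only parsing).
Local Notation r_eta := 3 (only parsing).
Local Notation r_M := 4 (only parsing).
Local Notation r_A := 5 (only parsing).
Local Notation r_m1 := 6 (only parsing).
Local Notation r_B := 7 (only parsing).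
Local Notation r_adj := 8 (only parsing).
Local Notation r_a := 9 (only parsing).
Local Notation r_j := 10 (only parsing).
Local Notation r_k := 11 (only parsing).
Local Notation r_Y := 12 (only parsing).
Local Notation r_b := 13 (only parsing).
Local Notation r_x := 14 (only parsing).
Local Notation r_y := 15 (only parsing).
Local Notation r_px := 16 (only parsing).
Local Notation r_py := 17 (only parsing).
Local Notation r_pb := 18 (only parsing).
Local Notation r_bx := 19 (only parsing).
Local Notation r_s := 20 (only parsing).
Local Notation r_u := 21 (only parsing).
Local Notation r_bad := 22 (only parsing).
Local Notation r_F := 23 (only parsing).
Local Notation r_G := 24 (only parsing).
Local Notation r_ut := 25 (only parsing).

(** * The program *)

(* [1 / (x + 1)] is the test [x = 0]. *)
Definition iszE (e : expr) : expr := Bin OpDiv (Cst 1) (e +' Cst 1).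
(** Wrap-around is harmless: two words with difference 0 modulo [2 ^ w] are equal. *)
Definition eqE (e1 e2 : expr) : expr := iszE (e1 -' e2).
Definition bitE (Y p : nat) : expr :=
  Bin OpMod (Bin OpDiv (Var Y) (Var p)) (Cst 2).

(** For the set coded by [r_Y]: its size, its utility for the current agent, and its number of
    ordered conflicting pairs. Recomputing them for every mask costs only a factor quadratic in
    [m]. *)
Definition stats : cmd :=
  Asg r_s (Cst 0) ;; Asg r_u (Cst 0) ;; Asg r_bad (Cst 0) ;; Asg r_px (Cst 1) ;;
  For r_x r_m (
    Asg r_bx (bitE r_Y r_px) ;;
    Asg r_s (Var r_s +' Var r_bx) ;;
    Asg r_u (Var r_u +' Var r_bx *' Mem (Var r_ut +' Var r_x)) ;;
    Asg r_py (Cst 1) ;;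
    For r_y r_m (
      Asg r_bad (Var r_bad +' Var r_bx *' (bitE r_Y r_py *'
        Mem (Var r_adj +' Var r_x *' Var r_m +' Var r_y))) ;;
      Asg r_py (Var r_py *' Cst 2)) ;;
    Asg r_px (Var r_px *' Cst 2)).

(** The quotient of [eta] by [u + 1] is zero iff [eta <= u], which turns the threshold test into
    arithmetic. *)
Definition fill_good : cmd :=
  For r_Y r_M (stats ;;
    Sto (Var r_A +' Var r_Y)
        (eqE (Var r_s) (Var r_j) *' (iszE (Var r_bad) *'
         iszE (Bin OpDiv (Var r_eta) (Var r_u +' Cst 1))))).

Definition fill_reach : cmd :=
  For r_Y r_M (stats ;;
    Sto (Var r_B +' Var r_Y)
        (eqE (Var r_s) (Var r_k) *' Mem (Var r_F +' Var r_Y))).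

Definition transform (o : binop) (r : nat) : cmd :=
  Asg r_pb (Cst 1) ;;
  For r_b r_m (
    For r_Y r_M (
      Sto (Var r +' Var r_Y)
          (Bin o (Mem (Var r +' Var r_Y)) (bitE r_Y r_pb *'
            Mem (Var r +' (Var r_Y -' bitE r_Y r_pb *' Var r_pb))))) ;;
    Asg r_pb (Var r_pb *' Cst 2)).

Definition pointwise : cmd :=
  For r_Y r_M (
    Sto (Var r_A +' Var r_Y)
        (Mem (Var r_A +' Var r_Y) *' Mem (Var r_B +' Var r_Y))).

(** The double zero test reduces the entry to 0 or 1 after each pair of sizes, so accumulation over
    all pairs cannot overflow. *)
Definition mark : cmd :=
  For r_Y r_M (stats ;;
    Sto (Var r_G +' Var r_Y)
        (iszE (iszE (Mem (Var r_G +' Var r_Y) +'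
          eqE (Var r_s) (Var r_j +' Var r_k) *' Mem (Var r_A +' Var r_Y))))).

Definition pass : cmd :=
  fill_good ;; fill_reach ;; transform OpAdd r_A ;; transform OpAdd r_B ;;
  pointwise ;; transform OpSub r_A ;; mark.

Definition read_sizes : cmd :=
  Asg r_n (Mem (Cst 0)) ;; Asg r_m (Mem (Cst 1)) ;; Asg r_eta (Mem (Cst 2)).

(** The mask 0 codes the empty set, the only set reachable without agents. The other entries of the
    first table are zero already, since memory beyond the input is. *)
Definition setup : cmd :=
  Asg r_M (Cst 1) ;; For r_b r_m (Asg r_M (Var r_M *' Cst 2)) ;;
  Asg r_adj (Cst 3 +' Var r_n *' Var r_m) ;;
  Asg r_A (Var r_adj +' Var r_m *' Var r_m) ;;
  Asg r_m1 (Var r_m +' Cst 1) ;;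
  Asg r_B (Var r_A +' Var r_M) ;;
  Asg r_F (Var r_B +' Var r_M) ;;
  Asg r_G (Var r_F +' Var r_M) ;;
  Asg r_ut (Cst 3) ;;
  Sto (Var r_F) (Cst 1).

(** Moving [r_F] and [r_G] on by [2 ^ m] cells per agent makes the next table start in untouched,
    hence zero, memory, so nothing has to be cleared. *)
Definition main : cmd :=
  For r_a r_n (
    For r_j r_m1 (For r_k r_m1 pass) ;;
    Asg r_F (Var r_G) ;;
    Asg r_G (Var r_G +' Var r_M) ;;
    Asg r_ut (Var r_ut +' Var r_m)) ;;
  Asg r_res (Cst 0) ;;
  For r_Y r_M (Asg r_res (iszE (iszE (Var r_res +' Mem (Var r_F +' Var r_Y))))).

(** Three separately compiled commands, because a command may not modify its own loop bounds: [r_n]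
    and [r_m] are set by the first, [r_M] and [r_m1] by the second. *)
Definition cffa_program : program :=
  let p1 := csize read_sizes in
  let p2 := p1 + csize setup in
  ccmd 0 read_sizes ++ ccmd p1 setup ++ ccmd p2 main.

(** * Evaluation of expressions *)

Arguments eval : simpl never.
Arguments sem : simpl never.

Fixpoint nosto (c : cmd) : bool :=
  match c with
  | Asg _ _ => true
  | Sto _ _ => false
  | Seq c1 c2 => nosto c1 && nosto c2
  | For _ _ c => nosto c
  end.

Lemma sem_nosto w c s : nosto c -> mm (sem w c s) = mm s.
Proof.
rewrite /sem; elim: c s => [r e|e1 e2|c1 IH1 c2 IH2|i b c IH] s //=.
  by case/andP=> h1 h2; rewrite IH2 // IH1.
by move=> h; elim: (rg s b) => //= k <-; rewrite IH.
Qed.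

(* The value of an expression with exact outer sums and products. *)
Fixpoint neval (w : nat) (s : store) (e : expr) : nat :=
  match e with
  | Var r => rg s r
  | Cst c => c
  | Bin OpAdd e1 e2 => neval w s e1 + neval w s e2
  | Bin OpMul e1 e2 => neval w s e1 * neval w s e2
  | _ => eval w s e
  end.

Lemma neval_mod w s e : eval w s e = neval w s e %[mod 2 ^ w].
Proof.
elim: e => [r|c|o e1 IH1 e2 IH2|e IH] //=; first by rewrite /eval modn_mod.
case: o => //=; rewrite {1}/eval /= -/(eval w s e1) -/(eval w s e2) modn_mod.
  by rewrite -modnDm IH1 IH2 modnDm.
by rewrite -modnMm IH1 IH2 modnMm.
Qed.

(** Expressions whose outermost operation reduces modulo [2 ^ w]. Their value is the reduced exact
    value, so a single size bound on the result suffices, whatever wraps inside. A bare register is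
    excluded because a store may hold any number. *)
Definition ring_expr (e : expr) : bool :=
  match e with Cst _ | Bin OpAdd _ _ | Bin OpMul _ _ => true | _ => false end.

Lemma eval_ring w s e : ring_expr e -> eval w s e = neval w s e %% 2 ^ w.
Proof.
rewrite -neval_mod; case: e => [r|c|o e1 e2|e] // ; first by rewrite /eval modn_mod.
by case: o => // _; rewrite {1}/eval /= -/(eval w s e1) -/(eval w s e2) /eval /= modn_mod.
Qed.

Lemma eval_small w s e : ring_expr e -> neval w s e < 2 ^ w ->
  eval w s e = neval w s e.
Proof. by move=> h1 h2; rewrite eval_ring // modn_small. Qed.

Lemma eval_isz w s e : 1 < 2 ^ w -> eval w s e < 2 ^ w ->
  eval w s (iszE e) = (eval w s e == 0).
Proof.
rewrite /iszE {2}/eval /= -/(eval w s e) => W1 eW; rewrite (modn_small W1).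
(* The largest word is special: adding 1 wraps to 0, and division by 0 yields 0, which happens to be
   the right answer for a nonzero value. *)
move: (eval w s e) eW => x; rewrite leq_eqVlt => /orP[/eqP xW|xW].
  by rewrite addn1 xW modnn divn0; case: x xW W1 => // <-.
by rewrite addn1 modn_small //; case: x xW => // x _; rewrite divn_small.
Qed.

Lemma eval_nz w s e : 1 < 2 ^ w -> eval w s e < 2 ^ w ->
  eval w s (iszE (iszE e)) = (eval w s e != 0).
Proof.
move=> W1 eW; rewrite eval_isz //; first by rewrite eval_isz //; case: (eval w s e == 0).
by rewrite eval_isz //; case: (eval w s e == 0) => //; exact: ltnW.
Qed.

Lemma eval_eq w s e1 e2 : 1 < 2 ^ w -> eval w s e1 < 2 ^ w ->
  eval w s e2 < 2 ^ w -> eval w s (eqE e1 e2) = (eval w s e1 == eval w s e2).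
Proof.
move=> W1 h1 h2; rewrite /eqE eval_isz // /eval /= -/(eval w s e1) -/(eval w s e2).
  move: (eval w s e1) (eval w s e2) h1 h2 => x y xW yW; congr (nat_of_bool _).
  have [xy|yx] := ltnP x y; first by rewrite modn_small; lia.
  by rewrite -addnBAC // modnDr modn_small; lia.
by rewrite ltn_pmod //; lia.
Qed.

Lemma eval_bit w s Y p b : 2 < 2 ^ w -> rg s p = 2 ^ b ->
  eval w s (bitE Y p) = bit b (rg s Y).
Proof. by move=> W2 pE; rewrite /eval /= pE (modn_small W2). Qed.

Lemma evalM w s e : eval w s (Mem e) = mm s (eval w s e).
Proof. by []. Qed.

Lemma eval_bin w s o e1 e2 :
  eval w s (Bin o e1 e2) = eval_binop w o (eval w s e1) (eval w s e2).
Proof. by []. Qed.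

Lemma eval_sub w s e1 e2 : eval w s e1 < 2 ^ w -> eval w s e2 <= eval w s e1 ->
  eval w s (e1 -' e2) = eval w s e1 - eval w s e2.
Proof.
move=> h1 h2; rewrite eval_bin /= -addnBAC // modnDr modn_small //.
by apply: leq_ltn_trans h1; rewrite leq_subr.
Qed.

Lemma eval_div w s e1 e2 :
  eval w s (Bin OpDiv e1 e2) = eval w s e1 %/ eval w s e2.
Proof. by []. Qed.

Lemma semA w r e s : sem w (Asg r e) s = setr s r (eval w s e).
Proof. by []. Qed.

Lemma semS w e1 e2 s : sem w (Sto e1 e2) s = setm s (eval w s e1) (eval w s e2).
Proof. by []. Qed.

Lemma semC w c1 c2 s : sem w (c1 ;; c2) s = sem w c2 (sem w c1 s).
Proof. by []. Qed.

Arguments upd f r v x /.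
Arguments setr s r v /.
Arguments setm s x v /.
Opaque expn sem.

(** * Correctness of the program on an abstract input *)

Section Correctness.
Variables (J : finType) (w n eta : nat) (inp : nat -> nat).
Variables (u : nat -> J -> nat) (e : rel J).
Local Notation m := #|J|.
Local Notation M := (2 ^ m).
Local Notation W := (2 ^ w).

Definition base := 3 + n * m + m * m.
Definition table (a : nat) := base + M + M + a * M.

(** [table n.+1] is the value of [r_G] after the last agent, the largest address ever formed. In
    [prod_W] the summand 1 is the old table entry to which [mark] adds a count of at most [M * M];
    in [u_W] it comes from the divisor [u + 1]. *)
Hypothesis table_W : table n.+1 < W.
Hypothesis prod_W : M * M + 1 < W.
Hypothesis eta_W : eta < W.
Hypothesis u_W : forall a, a < n -> \sum_x u a x + 1 < W.
Hypothesis inp_u : forall a x, a < n -> inp (3 + a * m + enum_rank x) = u a x.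
Hypothesis inp_e : forall x y,
  inp (3 + n * m + enum_rank x * m + enum_rank y) = e x y.

Definition good (a : nat) (S : {set J}) : bool :=
  (\sum_(x in S) \sum_(y in S) e x y == 0) && (eta <= \sum_(x in S) u a x).

(** The registers that are constant throughout [main] are numbered 1 to 8, so that framing them is
    the interval condition [0 < r < 9]. *)
Definition env (s : store) : Prop :=
  [/\ [/\ rg s r_n = n, rg s r_m = m, rg s r_eta = eta & rg s r_M = M],
      [/\ rg s r_A = base, rg s r_m1 = m.+1, rg s r_B = base + M
        & rg s r_adj = 3 + n * m]
    & forall i, i < base -> mm s i = inp i].

Lemma M_gt0 : 0 < M. Proof. by rewrite expn_gt0. Qed.

Lemma W_gt3 : 3 < W.
Proof. by have := table_W; rewrite /table /base; have := M_gt0; lia. Qed.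

Lemma m_ltM : m < M. Proof. exact: ltn_expl. Qed.

Lemma table_leW a : a <= n -> table a + M < W.
Proof.
move=> an; apply: leq_ltn_trans table_W; rewrite /table mulSn -addnA leq_add2l.
by rewrite addnC leq_add2l leq_mul2r an orbT.
Qed.

Lemma M_leW : base + M + M < W.
Proof. by have := table_leW (leq0n n); rewrite /table; lia. Qed.

Lemma bound_M x : x <= M -> x < W.
Proof. by have := M_leW; lia. Qed.

Lemma index_lt a c k l : a < c -> k < l -> a * l + k < c * l.
Proof.
move=> ac kl; apply: (@leq_trans (a.+1 * l)); last by rewrite leq_mul2r ac orbT.
by rewrite mulSn addnC ltn_add2r.
Qed.

Lemma utility_lt a k : a < n -> k < m -> 3 + a * m + k < base.
Proof.
by move=> an km; rewrite /base ltn_addr // -addnA ltn_add2l index_lt.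
Qed.

Lemma conflict_lt k l : k < m -> l < m -> 3 + n * m + k * m + l < base.
Proof. by move=> km lm; rewrite /base -addnA ltn_add2l index_lt. Qed.

Lemma base_ltW x : x < base -> x < W.
Proof. by have := M_leW; lia. Qed.

Lemma card_ltW (S : {set J}) : #|S| < W.
Proof. exact: bound_M (leq_trans (max_card _) (ltnW m_ltM)). Qed.

Lemma util_ltW a (S : {set J}) : a < n -> \sum_(x in S) u a x + 1 < W.
Proof.
move=> an; apply: leq_ltn_trans (u_W an); rewrite leq_add2r.
by rewrite [leqRHS](bigID (mem S)) leq_addr.
Qed.

Lemma conflicts_ltW (S : {set J}) : \sum_(x in S) \sum_(y in S) e x y < W.
Proof.
apply: (@leq_ltn_trans (m * m)); last by apply: base_ltW; rewrite /base; lia.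
apply: (@leq_trans (\sum_(x in S) m)); last first.
  by rewrite sum_nat_const leq_mul2r max_card orbT.
apply: leq_sum => x _; apply: leq_trans (max_card (mem S)).
by rewrite -sum1_card; apply: leq_sum => y _; apply: leq_b1.
Qed.

Lemma stats_ok s a Y : env s -> rg s r_Y = Y -> rg s r_ut = 3 + a * m ->
  a < n -> Y < M ->
  [/\ rg (sem w stats s) r_s = #|mset J Y|,
      rg (sem w stats s) r_u = \sum_(x in mset J Y) u a x
    & rg (sem w stats s) r_bad = \sum_(x in mset J Y) \sum_(y in mset J Y) e x y].
Proof.
case=> [[nE mE etaE ME] [AE m1E BE adjE] inpE] YE utE an YM.
pose u' x := inp (3 + a * m + x).
pose e' x y := inp (3 + n * m + x * m + y).
have W2 := ltnW W_gt3.
have small x : x <= M -> x %% W = x by move=> /bound_M; exact: modn_small.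
have pow2 k : k < m -> (2 ^ k * 2) %% W = 2 ^ k.+1.
  by move=> km; rewrite mulnC -expnS small // leq_exp2l.
rewrite /stats !semC !semA.
set s0 := setr _ _ _.
(* Keeping the partial sums modulo [W] defers all size bounds to the final values. *)
pose I k s' := [/\ rg s' r_px = 2 ^ k,
  rg s' r_s = (\sum_(x < k) bit x Y) %% W,
  rg s' r_u = (\sum_(x < k) bit x Y * u' x) %% W,
  rg s' r_bad = (\sum_(x < k) bit x Y * \sum_(y < m) bit y Y * e' x y) %% W
  & mm s' = mm s].
set c := For _ _ _.
have : I (rg s0 r_m) (sem w c s0).
  apply: for_rule => //.
  - by rewrite /= mE; apply: bound_M (ltnW m_ltM).
  - rewrite /I /= !big_ord0 /eval /= !mod0n expn0 modn_small //; exact: ltnW.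
  move=> k s1 /=; rewrite mE => km xE fr [pxE sE uE badE memE].
  have YE1 : rg s1 r_Y = Y by rewrite fr.
  have utE1 : rg s1 r_ut = 3 + a * m by rewrite fr.
  have mE1 : rg s1 r_m = m by rewrite fr.
  have adjE1 : rg s1 r_adj = 3 + n * m by rewrite fr.
  have bE : eval w s1 (bitE r_Y r_px) = bit k Y by rewrite (eval_bit _ W2 pxE) YE1.
  rewrite semC [sem w (Asg r_bx _) s1]semA bE semC semA semC semA semC semA.
  set s2 := setr s1 _ _.
  have sE2 : eval w s2 (Var r_s +' Var r_bx) = (\sum_(x < k.+1) bit x Y) %% W.
    by rewrite eval_ring //= sE modnDml big_ord_recr.
  rewrite sE2; set s3 := setr s2 _ _.
  have uE2 : eval w s3 (Var r_u +' Var r_bx *' Mem (Var r_ut +' Var r_x)) =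
      (\sum_(x < k.+1) bit x Y * u' x) %% W.
    have uk : eval w s3 (Var r_ut +' Var r_x) = 3 + a * m + k.
      rewrite eval_small //= utE1 xE //.
      exact/base_ltW/utility_lt.
    rewrite eval_ring //= uE modnDml big_ord_recr /=; congr ((_ + _ * _) %% _).
    by rewrite evalM uk /= memE inpE // utility_lt.
  rewrite uE2; set s4 := setr s3 _ _; set s5 := setr s4 _ _.
  set d := For r_y _ _.
  pose I' l s' := [/\ rg s' r_py = 2 ^ l,
    rg s' r_bad = (\sum_(x < k) bit x Y * (\sum_(y < m) bit y Y * e' x y) +
                   bit k Y * \sum_(y < l) bit y Y * e' k y) %% W
    & mm s' = mm s].
  have : I' (rg s5 r_m) (sem w d s5).
    apply: for_rule => //.
    + by rewrite /= mE1; apply: bound_M (ltnW m_ltM).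
    + rewrite /I' /= big_ord0 muln0 addn0; split=> //.
      rewrite /eval expn0 modn_small //; exact: ltnW.
    move=> l s' lm yE fr' [pyE badE' memE'].
    have lm' : l < m by move: lm; rewrite /= mE1.
    have YE2 : rg s' r_Y = Y by rewrite fr'.
    have ptr : eval w s' (Var r_adj +' Var r_x *' Var r_m +' Var r_y) =
        3 + n * m + k * m + l.
      rewrite eval_small //= yE !fr' //= adjE1 xE mE1 //.
      exact/base_ltW/conflict_lt.
    have be : eval w s' (Var r_bad +' Var r_bx *' (bitE r_Y r_py *'
        Mem (Var r_adj +' Var r_x *' Var r_m +' Var r_y))) =
      (\sum_(x < k) bit x Y * (\sum_(y < m) bit y Y * e' x y) +
                   bit k Y * \sum_(y < l.+1) bit y Y * e' k y) %% W.
      rewrite eval_ring //= (eval_bit _ W2 pyE) YE2 evalM ptr badE' modnDml memE'.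
      rewrite big_ord_recr /= mulnDr addnA inpE ?conflict_lt //.
      by rewrite fr'.
    rewrite semC !semA be; split=> //=.
    by rewrite eval_ring //= pyE pow2.
  rewrite /= mE1 => -[_ badE5 memE5].
  rewrite semC semA; set s6 := sem w d s5.
  have fr6 r : ~~ mods d r -> rg s6 r = rg s5 r by exact: sem_frame.
  split=> //=.
  - by rewrite eval_ring //= fr6 //= pxE pow2.
  - by rewrite fr6.
  - by rewrite fr6.
  - by rewrite badE5 big_ord_recr.
rewrite /= mE => -[_ -> -> -> _].
have cardE : \sum_(x < m) bit x Y = #|mset J Y|.
  rewrite -sum1_card -(@sum_mset _ (fun=> 1) (fun=> 1)) //.
  by apply: eq_bigr => x _; rewrite muln1.
have uE : \sum_(x < m) bit x Y * u' x = \sum_(x in mset J Y) u a x.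
  by apply: sum_mset => x; apply: inp_u.
have badE : \sum_(x < m) bit x Y * \sum_(y < m) bit y Y * e' x y =
    \sum_(x in mset J Y) \sum_(y in mset J Y) e x y.
  apply: (@sum_mset _ (fun x => \sum_(y in mset J Y) e x y)
                      (fun x => \sum_(y < m) bit y Y * e' x y)) => x.
  by apply: sum_mset => y; apply: inp_e.
rewrite cardE uE badE !modn_small //.
- exact: conflicts_ltW.
- by have := util_ltW (mset J Y) an; lia.
- exact: card_ltW.
Qed.

Lemma env_frame s s' : env s ->
  (forall r, 0 < r < 9 -> rg s' r = rg s r) ->
  (forall i, i < base -> mm s' i = mm s i) -> env s'.
Proof.
case=> [[nE mE etaE ME] [AE m1E BE adjE] inpE] rE mmE.
by split; first (by split; rewrite rE); first (by split; rewrite rE);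
  move=> i ib; rewrite mmE ?inpE.
Qed.

(** The loop fills an array in increasing order. The premise describes memory in the middle of the
    loop, with the cells before [Y] already overwritten and the rest old, so it also serves loops
    that read the array they write. *)
Lemma map_loop c o (v : nat -> nat) s :
  ~~ mods c r_Y -> ~~ mods c r_M -> rg s r_M = M ->
  (forall Y s', Y < M -> rg s' r_Y = Y ->
    (forall r, r != r_Y -> ~~ mods c r -> rg s' r = rg s r) ->
    (forall i, mm s' i = if o <= i < o + Y then v (i - o) else mm s i) ->
    mm (sem w c s') =1 upd (mm s') (o + Y) (v Y)) ->
  forall i, mm (sem w (For r_Y r_M c) s) i =
    if o <= i < o + M then v (i - o) else mm s i.
Proof.
move=> cY cM ME step; rewrite -{1}ME.
pose I k s' := forall i, mm s' i = if o <= i < o + k then v (i - o) else mm s i.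
apply: (@for_rule _ _ _ _ _ I) => //.
- by rewrite ME; apply: bound_M.
- by move=> i; case: ifP => //; lia.
move=> k s' kM YE fr Is' i; rewrite ME in kM.
rewrite /= (step k s') //= Is'; case: eqP => [->|ne].
  by rewrite ifT ?addKn //; lia.
by have -> : (o <= i < o + k.+1) = (o <= i < o + k) by lia.
Qed.

Lemma eval_var s r : eval w s (Var r) = rg s r.
Proof. by []. Qed.

Lemma W_gt1 : 1 < W. Proof. by have := W_gt3; lia. Qed.

Lemma fill_good_ok a j s : env s -> rg s r_j = j -> rg s r_ut = 3 + a * m ->
  a < n -> j <= m ->
  forall i, mm (sem w fill_good s) i =
    if base <= i < base + M then good_of_size good a j (mset J (i - base))
    else mm s i.
Proof.
move=> En jE utE an jm.
apply: (@map_loop _ base (fun Y => good_of_size good a j (mset J Y))) => //.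
  by case: En => -[].
move=> Y s' YM YE fr mmE.
have En' : env s'.
  apply: env_frame En _ _ => [r r9|i ib]; first by rewrite fr //=; lia.
  by rewrite mmE ifF //; lia.
have [sE uE badE] := stats_ok En' YE (etrans (fr r_ut isT isT) utE) an YM.
rewrite semC semS; set s2 := sem w stats s' in sE uE badE *.
have fr2 r : ~~ mods stats r -> rg s2 r = rg s' r by exact: sem_frame.
have [[nE mE etaE ME] [AE m1E BE adjE] inpE] := En'.
have addr : eval w s2 (Var r_A +' Var r_Y) = base + Y.
  by rewrite eval_small //= !fr2 //= AE YE //; have := M_leW; lia.
have W1 := W_gt1; have W0 := ltnW W1.
have v1 : eval w s2 (eqE (Var r_s) (Var r_j)) = (#|mset J Y| == j).
  rewrite eval_eq ?eval_var ?sE ?fr2 ?fr ?jE ?card_ltW //.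
  by apply: bound_M (leq_trans jm (ltnW m_ltM)).
have v2 : eval w s2 (iszE (Var r_bad)) =
    (\sum_(x in mset J Y) \sum_(y in mset J Y) e x y == 0).
  by rewrite eval_isz ?eval_var ?badE ?conflicts_ltW.
have v3 : eval w s2 (iszE (Bin OpDiv (Var r_eta) (Var r_u +' Cst 1))) =
    (eta <= \sum_(x in mset J Y) u a x).
  have dE : eval w s2 (Bin OpDiv (Var r_eta) (Var r_u +' Cst 1)) =
      eta %/ (\sum_(x in mset J Y) u a x + 1).
    rewrite eval_div eval_var fr2 // etaE eval_small //= ?uE // util_ltW //.
  rewrite eval_isz ?dE ?(leq_ltn_trans (leq_div _ _)) //.
  by rewrite -leqn0 leqNgt divn_gt0 ?addn1 // -leqNgt.
move=> i; rewrite /= addr [mm s2]sem_nosto //; congr (if _ then _ else _).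
rewrite eval_ring //= v1 v2 v3 /good_of_size /good.
have K (b1 b2 b3 : bool) : (b1 * (b2 * b3)) %% W = (b2 && b3) && b1.
  by case: b1; case: b2; case: b3; rewrite modn_small.
exact: K.
Qed.

Lemma table_ltW a Y : a <= n -> Y < M -> table a + Y < W.
Proof. by move=> an YM; have := table_leW an; lia. Qed.

Lemma table_ge a : base + M + M <= table a.
Proof. by rewrite /table; lia. Qed.

Lemma reach_step_ltW x y (b : bool) : x <= 1 -> y <= M * M -> x + b * y < W.
Proof. by have := prod_W; case: b; lia. Qed.

Lemma fill_reach_ok a k s : env s -> rg s r_k = k -> rg s r_ut = 3 + a * m ->
  rg s r_F = table a -> a < n -> k <= m ->
  (forall Y, Y < M -> mm s (table a + Y) = reach good a (mset J Y)) ->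
  forall i, mm (sem w fill_reach s) i =
    if base + M <= i < base + M + M
    then reach_of_size good a k (mset J (i - (base + M))) else mm s i.
Proof.
move=> En kE utE FE an km Fval.
apply: (@map_loop _ _ (fun Y => reach_of_size good a k (mset J Y))) => //.
  by case: En => -[].
move=> Y s' YM YE fr mmE.
have En' : env s'.
  apply: env_frame En _ _ => [r r9|i ib]; first by rewrite fr //=; lia.
  by rewrite mmE ifF //; lia.
have [sE _ _] := stats_ok En' YE (etrans (fr r_ut isT isT) utE) an YM.
rewrite semC semS; set s2 := sem w stats s' in sE *.
have fr2 r : ~~ mods stats r -> rg s2 r = rg s' r by exact: sem_frame.
have [[nE mE etaE ME] [AE m1E BE adjE] inpE] := En'.
have addr : eval w s2 (Var r_B +' Var r_Y) = base + M + Y.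
  by rewrite eval_small //= !fr2 //= BE YE //; have := M_leW; lia.
have addrF : eval w s2 (Var r_F +' Var r_Y) = table a + Y.
  by rewrite eval_small //= !fr2 //= fr // FE YE // table_ltW // ltnW.
have W1 := W_gt1; have W0 := ltnW W1.
have v1 : eval w s2 (eqE (Var r_s) (Var r_k)) = (#|mset J Y| == k).
  rewrite eval_eq ?eval_var ?sE ?fr2 ?fr ?kE ?card_ltW //.
  by apply: bound_M (leq_trans km (ltnW m_ltM)).
move=> i; rewrite /= addr [mm s2]sem_nosto //; congr (if _ then _ else _).
rewrite eval_ring //= v1 evalM addrF sem_nosto // mmE ifF; last first.
  by have := table_ge a; lia.
rewrite Fval // /reach_of_size.
by case: (reach _ _ _); case: (_ == _); rewrite modn_small.
Qed.

Lemma mark_ok a j k s : env s -> rg s r_j = j -> rg s r_k = k ->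
  rg s r_ut = 3 + a * m -> rg s r_G = table a.+1 -> a < n -> j <= m -> k <= m ->
  (forall Y, Y < M -> mm s (table a.+1 + Y) <= 1) ->
  (forall Y, Y < M -> mm s (base + Y) =
    uprod (good_of_size good a j) (reach_of_size good a k) (mset J Y)) ->
  (forall Y, Y < M -> mm s (base + Y) <= M * M) ->
  forall i, mm (sem w mark s) i =
    if table a.+1 <= i < table a.+1 + M
    then (mm s (table a.+1 + (i - table a.+1)) +
          hits good a j k (mset J (i - table a.+1)) != 0) : nat
    else mm s i.
Proof.
move=> En jE kE utE GE an jm km old Aval AM.
apply: (@map_loop _ _ (fun Y => mm s (table a.+1 + Y) +
  hits good a j k (mset J Y) != 0)) => //.
  by case: En => -[].
move=> Y s' YM YE fr mmE.
have tge := table_ge a.+1.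
have En' : env s'.
  apply: env_frame En _ _ => [r r9|i ib]; first by rewrite fr //=; lia.
  by rewrite mmE ifF //; lia.
have [sE _ _] := stats_ok En' YE (etrans (fr r_ut isT isT) utE) an YM.
rewrite semC semS; set s2 := sem w stats s' in sE *.
have fr2 r : ~~ mods stats r -> rg s2 r = rg s' r by exact: sem_frame.
have [[nE mE etaE ME] [AE m1E BE adjE] inpE] := En'.
have addrA : eval w s2 (Var r_A +' Var r_Y) = base + Y.
  by rewrite eval_small //= !fr2 //= AE YE //; have := M_leW; lia.
have addrG : eval w s2 (Var r_G +' Var r_Y) = table a.+1 + Y.
  by rewrite eval_small //= !fr2 //= fr // GE YE // table_ltW.
have W1 := W_gt1; have W0 := ltnW W1.
have mW := bound_M (ltnW m_ltM).
have jkE : eval w s2 (Var r_j +' Var r_k) = j + k.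
  rewrite eval_small //= !fr2 // !fr // jE kE //.
  by have := M_leW; have := m_ltM; lia.
have v1 : eval w s2 (eqE (Var r_s) (Var r_j +' Var r_k)) = (#|mset J Y| == j + k).
  rewrite eval_eq ?jkE ?eval_var ?sE ?card_ltW //.
  by have := M_leW; have := m_ltM; lia.
have mA : mm s2 (base + Y) =
    uprod (good_of_size good a j) (reach_of_size good a k) (mset J Y).
  by rewrite sem_nosto // mmE ifF ?Aval //; lia.
have mG : mm s2 (table a.+1 + Y) = mm s (table a.+1 + Y).
  by rewrite sem_nosto // mmE ifF //; lia.
set ex := Mem (Var r_G +' Var r_Y) +'
  eqE (Var r_s) (Var r_j +' Var r_k) *' Mem (Var r_A +' Var r_Y).
have exE : eval w s2 ex = mm s (table a.+1 + Y) + hits good a j k (mset J Y).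
  rewrite eval_small //= !evalM addrG addrA v1 mA mG //.
  by rewrite reach_step_ltW ?old // -Aval // AM.
have exW : eval w s2 ex < W.
  by rewrite exE reach_step_ltW ?old // -Aval // AM.
move=> i; rewrite /= addrG [mm s2]sem_nosto //; congr (if _ then _ else _).
by rewrite eval_nz // exE.
Qed.

Lemma pointwise_ok s : env s ->
  (forall Y, Y < M -> mm s (base + Y) * mm s (base + M + Y) < W) ->
  forall i, mm (sem w pointwise s) i =
    if base <= i < base + M
    then mm s (base + (i - base)) * mm s (base + M + (i - base)) else mm s i.
Proof.
move=> En pW.
apply: (@map_loop _ _ (fun Y => mm s (base + Y) * mm s (base + M + Y))) => //.
  by case: En => -[].
move=> Y s' YM YE fr mmE; rewrite semS.
have [[nE mE etaE ME] [AE m1E BE adjE] inpE] := En.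
have addrA : eval w s' (Var r_A +' Var r_Y) = base + Y.
  by rewrite eval_small //= fr // AE YE //; have := M_leW; lia.
have addrB : eval w s' (Var r_B +' Var r_Y) = base + M + Y.
  by rewrite eval_small //= fr // BE YE //; have := M_leW; lia.
move=> i; rewrite /= addrA; congr (if _ then _ else _).
rewrite eval_ring //= !evalM addrA addrB !mmE !ifF ?modn_small ?pW //; lia.
Qed.

(* In place: the cell of [Y] with bit [b] removed does not change in round [b],
   so it does not matter that it has already been visited. *)
Lemma transform_ok o r A (V : nat -> nat -> nat) s : env s ->
  0 < r < 9 -> rg s r = A -> base <= A -> A + M < W ->
  (forall Y, Y < M -> mm s (A + Y) = V 0 Y) ->
  (forall (b : 'I_m) Y, Y < M ->
    V b.+1 Y = eval_binop w o (V b Y)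
      ((bit b Y * V b (Y - bit b Y * 2 ^ b)) %% W)) ->
  (forall (b : 'I_m) Y, Y < M -> bit b Y = 1 ->
    V b.+1 (Y - 2 ^ b) = V b (Y - 2 ^ b)) ->
  forall i, mm (sem w (transform o r) s) i =
    if A <= i < A + M then V m (i - A) else mm s i.
Proof.
move=> En r9 rE bA AW V0 VS Vfix.
have [[nE mE etaE ME] [AE m1E BE adjE] inpE] := En.
have r12 : (r == r_Y) = false by lia.
have r13 : (r == r_b) = false by lia.
have r18 : (r == r_pb) = false by lia.
rewrite /transform semC semA.
have W1 := W_gt1; have W0 := ltnW W1.
set s0 := setr _ _ _; set c := For r_b _ _.
pose I k s' := rg s' r_pb = 2 ^ k /\ forall i, mm s' i =
  if A <= i < A + M then V k (i - A) else mm s i.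
suff : I (rg s0 r_m) (sem w c s0) by rewrite /= mE => -[].
apply: for_rule => //.
- by rewrite /= mE; apply: bound_M (ltnW m_ltM).
- split=> [|i /=]; first by rewrite /= /eval expn0 modn_small.
  by case: ifP => // /andP[h1 h2]; rewrite -V0 ?subnKC // ltn_subLR.

move=> k s1; rewrite [rg s0 _]/= mE => km kE fr [pbE memE].
pose b := Ordinal km.
rewrite semC semA.
set d := For r_Y _ _; set s2 := sem w d s1.
have fr2 r' : ~~ mods d r' -> rg s2 r' = rg s1 r' by exact: sem_frame.
split.
  rewrite /= eval_ring //= fr2 // pbE mulnC -expnS modn_small //.
  by apply: bound_M; rewrite leq_exp2l.
have H : forall i, mm s2 i = if A <= i < A + M then V k.+1 (i - A) else mm s1 i.
  apply: (@map_loop _ A (fun Y => V k.+1 Y)) => //.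
    by rewrite fr.
  move=> Y s' YM YE fr' mmE; rewrite semS.
  have rE' : rg s' r = A.
    by rewrite fr' ?fr /= ?r12 ?r13 ?r18.
  have addr : eval w s' (Var r +' Var r_Y) = A + Y.
    by rewrite eval_small //= rE' YE //; lia.
  have bE : eval w s' (bitE r_Y r_pb) = bit b Y.
    by rewrite (@eval_bit _ _ _ _ b) ?YE ?fr' // ltnW // W_gt3.
  have bY : bit b Y * 2 ^ b <= Y.
    by rewrite bit_bool; case: eqP => [/bit_leq|] //; rewrite mul1n.
  have subE : eval w s' (Var r_Y -' bitE r_Y r_pb *' Var r_pb) =
      Y - bit b Y * 2 ^ b.
    have pE : eval w s' (bitE r_Y r_pb *' Var r_pb) = bit b Y * 2 ^ b.
      have pbE' : rg s' r_pb = 2 ^ b by rewrite fr'.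
      by rewrite eval_small //= bE pbE' // (leq_ltn_trans bY) // bound_M // ltnW.
    by rewrite eval_sub ?pE ?eval_var ?YE // bound_M // ltnW.
  have addr2 : eval w s' (Var r +' (Var r_Y -' bitE r_Y r_pb *' Var r_pb)) =
      A + (Y - bit b Y * 2 ^ b).
    by rewrite eval_small //= rE' subE //; lia.
  move=> i; rewrite /= addr; congr (if _ then _ else _).
  have -> : V k.+1 Y = V b.+1 Y by [].
  rewrite (VS b) // eval_bin evalM addr eval_ring //= evalM addr2 bE.
  have old : mm s' (A + Y) = V k Y.
    by rewrite mmE ifF ?memE ?ifT ?addKn //; lia.
  rewrite old; congr (eval_binop _ _ _ (_ %% _)).
  have [h|->] : bit b Y = 1 \/ bit b Y = 0; last by rewrite !mul0n.
    by case: (bit b Y) (bit_lt2 b Y) => [|[]]; auto.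
  have ltb := bit_leq h; have p0 : 0 < 2 ^ b by rewrite expn_gt0.
  rewrite h !mul1n mmE ifT ?addKn; last by lia.
  exact: (Vfix b).
by move=> i; rewrite /= H memE; case: (A <= i < A + M).
Qed.

Lemma zeta_transform_ok r A f s : env s ->
  0 < r < 9 -> rg s r = A -> base <= A -> A + M < W ->
  (forall P Y, zeta P f Y < W) ->
  (forall Y, Y < M -> mm s (A + Y) = f (mset J Y)) ->
  forall i, mm (sem w (transform OpAdd r) s) i =
    if A <= i < A + M then zeta setT f (mset J (i - A)) else mm s i.
Proof.
move=> En r9 rE bA AW fW fA; rewrite -bits_belowT.
apply: (@transform_ok OpAdd r A (fun b Y => zeta (bits_below J b) f (mset J Y))) => //.
- by move=> Y YM; rewrite bits_below0 zeta0 fA.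
- by move=> b Y YM; rewrite /= modnDmr -zeta_step modn_small.
- by move=> b Y YM h; rewrite zeta_step bit_sub // eqxx mul0n addn0.
Qed.

Lemma moebius_transform_ok r A f s : env s ->
  0 < r < 9 -> rg s r = A -> base <= A -> A + M < W ->
  (forall P Y, zeta P f Y < W) ->
  (forall Y, Y < M -> mm s (A + Y) = zeta setT f (mset J Y)) ->
  forall i, mm (sem w (transform OpSub r) s) i =
    if A <= i < A + M then f (mset J (i - A)) else mm s i.
Proof.
move=> En r9 rE bA AW fW fA i.
have h := @transform_ok OpSub r A
  (fun b Y => zeta (~: bits_below J b) f (mset J Y)) s En r9 rE bA AW.
rewrite h ?bits_belowT ?setCT ?zeta0 //.
- by move=> Y YM; rewrite bits_below0 setC0 fA.
- move=> b Y YM; have mb := moebius_step b f Y.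
  (* By [mb] the minuend is the wanted value plus the subtrahend, so the subtraction modulo [W] is
     exact. *)
  rewrite /= [X in _ - X]modn_small; last first.
    by apply: leq_ltn_trans (fW (~: bits_below J b) (mset J Y)); rewrite mb leq_addl.
  rewrite {1}mb addnAC addnK modnDr modn_small //.
- by move=> b Y YM h'; rewrite [RHS]moebius_step bit_sub // eqxx mul0n addn0.
Qed.

Lemma env_sem c s : env s -> (forall r, 0 < r < 9 -> ~~ mods c r) ->
  (forall i, i < base -> mm (sem w c s) i = mm s i) -> env (sem w c s).
Proof.
by move=> En cm mmE; apply: env_frame En _ mmE => r r9; rewrite sem_frame ?cm.
Qed.

(** The two work arrays are left out of the description on both sides: every pass refills them
    before reading them. *)
Lemma pass_ok a j k s : env s -> rg s r_j = j -> rg s r_k = k ->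
  rg s r_ut = 3 + a * m -> rg s r_F = table a -> rg s r_G = table a.+1 ->
  a < n -> j <= m -> k <= m ->
  (forall Y, Y < M -> mm s (table a + Y) = reach good a (mset J Y)) ->
  (forall Y, Y < M -> mm s (table a.+1 + Y) <= 1) ->
  forall i, ~~ (base <= i < base + M + M) -> mm (sem w pass s) i =
    if table a.+1 <= i < table a.+1 + M
    then (mm s i + hits good a j k (mset J (i - table a.+1)) != 0) : nat
    else mm s i.
Proof.
move=> En jE kE utE FE GE an jm km Fval old.
have tge := table_ge a; have tge' := table_ge a.+1; have MW := M_leW.
pose f := good_of_size good a j; pose g := reach_of_size good a k.
have fW P Y : zeta P f Y < W by apply: bound_M (zeta_indicator _ _ _).
have gW P Y : zeta P g Y < W by apply: bound_M (zeta_indicator _ _ _).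
have fgM Y : zeta setT f Y * zeta setT g Y <= M * M.
  by rewrite leq_mul ?zeta_indicator.
have uM P Y : zeta P (uprod f g) Y <= M * M.
  by apply: leq_trans (zeta_leT _ _ _) _; rewrite zetaT_uprod.
have MMW : M * M < W by have := prod_W; lia.
have uW P Y : zeta P (uprod f g) Y < W by apply: leq_ltn_trans (uM _ _) MMW.
rewrite /pass 6!semC.
have m1 := fill_good_ok En jE utE an jm.
have En1 : env (sem w fill_good s).
  by apply: env_sem => //= [r|i ib]; [lia | rewrite m1 ifF //; lia].
have fr1 r : ~~ mods fill_good r -> rg (sem w fill_good s) r = rg s r by exact: sem_frame.
(* Each stage is summarised by its memory, its environment and its frame, and its store is then made
   a variable, so that the terms do not grow from stage to stage. *)
move: (sem w fill_good s) m1 En1 fr1 => s1 m1 En1 fr1.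
have m2 : forall i, mm (sem w fill_reach s1) i = if base + M <= i < base + M + M
    then g (mset J (i - (base + M))) else mm s1 i.
  apply: fill_reach_ok => //; rewrite ?fr1 // => Y YM.
  by rewrite m1 ifF ?Fval //; lia.
have En2 : env (sem w fill_reach s1).
  by apply: env_sem => //= [r|i ib]; [lia | rewrite m2 ifF //; lia].
have fr2 r : ~~ mods fill_reach r -> rg (sem w fill_reach s1) r = rg s1 r by exact: sem_frame.
move: (sem w fill_reach s1) m2 En2 fr2 => s2 m2 En2 fr2.
have m3 : forall i, mm (sem w (transform OpAdd r_A) s2) i =
    if base <= i < base + M then zeta setT f (mset J (i - base)) else mm s2 i.
  apply: zeta_transform_ok => //; first by case: En2 => _ [].
    by lia.
  by move=> Y YM; rewrite m2 ifF ?m1 ?ifT ?addKn //; lia.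
have En3 : env (sem w (transform OpAdd r_A) s2).
  by apply: env_sem => //= [r|i ib]; [lia | rewrite m3 ifF //; lia].
have fr3 r : ~~ mods (transform OpAdd r_A) r -> rg (sem w (transform OpAdd r_A) s2) r = rg s2 r.
  exact: sem_frame.
move: (sem w (transform OpAdd r_A) s2) m3 En3 fr3 => s3 m3 En3 fr3.
have m4 : forall i, mm (sem w (transform OpAdd r_B) s3) i =
    if base + M <= i < base + M + M then zeta setT g (mset J (i - (base + M))) else mm s3 i.
  apply: zeta_transform_ok => //; first by case: En3 => _ [].
    by lia.
  by move=> Y YM; rewrite m3 ifF ?m2 ?ifT ?addKn //; lia.
have En4 : env (sem w (transform OpAdd r_B) s3).
  by apply: env_sem => //= [r|i ib]; [lia | rewrite m4 ifF //; lia].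
have fr4 r : ~~ mods (transform OpAdd r_B) r -> rg (sem w (transform OpAdd r_B) s3) r = rg s3 r.
  exact: sem_frame.
move: (sem w (transform OpAdd r_B) s3) m4 En4 fr4 => s4 m4 En4 fr4.
have m4A Y : Y < M -> mm s4 (base + Y) = zeta setT f (mset J Y).
  by move=> YM; rewrite m4 ifF ?m3 ?ifT ?addKn //; lia.
have m4B Y : Y < M -> mm s4 (base + M + Y) = zeta setT g (mset J Y).
  by move=> YM; rewrite m4 ifT ?addKn //; lia.
have m5 : forall i, mm (sem w pointwise s4) i = if base <= i < base + M
    then mm s4 (base + (i - base)) * mm s4 (base + M + (i - base)) else mm s4 i.
  apply: pointwise_ok => // Y YM.
  by rewrite m4A // m4B //; apply: leq_ltn_trans MMW.
have En5 : env (sem w pointwise s4).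
  by apply: env_sem => //= [r|i ib]; [lia | rewrite m5 ifF //; lia].
have fr5 r : ~~ mods pointwise r -> rg (sem w pointwise s4) r = rg s4 r by exact: sem_frame.
move: (sem w pointwise s4) m5 En5 fr5 => s5 m5 En5 fr5.
have m6 : forall i, mm (sem w (transform OpSub r_A) s5) i =
    if base <= i < base + M then uprod f g (mset J (i - base)) else mm s5 i.
  apply: moebius_transform_ok => //; first by case: En5 => _ [].
    by lia.
  move=> Y YM; rewrite m5 ifT ?addKn; last by lia.
  by rewrite m4A // m4B // zetaT_uprod.
have En6 : env (sem w (transform OpSub r_A) s5).
  by apply: env_sem => //= [r|i ib]; [lia | rewrite m6 ifF //; lia].
have fr6 r : ~~ mods (transform OpSub r_A) r -> rg (sem w (transform OpSub r_A) s5) r = rg s5 r.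
  exact: sem_frame.
move: (sem w (transform OpSub r_A) s5) m6 En6 fr6 => s6 m6 En6 fr6.
have out i : ~~ (base <= i < base + M + M) -> mm s6 i = mm s i.
  move=> iout; rewrite m6 ifF; last by lia.
  rewrite m5 ifF; last by lia.
  rewrite m4 ifF; last by lia.
  rewrite m3 ifF; last by lia.
  rewrite m2 ifF; last by lia.
  by rewrite m1 ifF //; lia.
have fr r : ~~ mods pass r -> rg s6 r = rg s r.
  have -> : mods pass r = [|| mods fill_good r, mods fill_reach r,
      mods (transform OpAdd r_A) r, mods (transform OpAdd r_B) r,
      mods pointwise r, mods (transform OpSub r_A) r | mods mark r] by [].
  case/norP=> h1 /norP[h2 /norP[h3 /norP[h4 /norP[h5 /norP[h6 _]]]]].
  by rewrite fr6 // fr5 // fr4 // fr3 // fr2 // fr1.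
have A6 Y : Y < M -> mm s6 (base + Y) = uprod f g (mset J Y).
  by move=> YM; rewrite m6 ifT ?addKn //; lia.
move=> i iout; rewrite (@mark_ok a j k s6) ?fr //.
- by case: ifP => [/andP[ti _]|_]; rewrite ?subnKC ?out.
- by move=> Y YM; rewrite out ?old //; lia.
- move=> Y YM; rewrite A6 // -zeta0; exact: uM.
Qed.

Lemma env_setr r v s : env s -> 8 < r -> env (setr s r v).
Proof.
by move=> En r8; apply: env_frame En _ _ => // r' r'9; rewrite /= ifN //; lia.
Qed.

Lemma tableS a : table a.+1 = table a + M.
Proof. by rewrite /table mulSn [M + a * M]addnC addnA. Qed.

(** [t] is the total count accumulated so far for the next agent count, of which memory keeps only
    the truth value. The last clause guarantees an empty table for the following agent. *)
Definition tables (a : nat) (t : nat -> nat) (s : store) : Prop :=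
  [/\ env s, [/\ rg s r_ut = 3 + a * m, rg s r_F = table a & rg s r_G = table a.+1],
      forall Y, Y < M -> mm s (table a + Y) = reach good a (mset J Y),
      forall Y, Y < M -> mm s (table a.+1 + Y) = (t Y != 0)
    & forall i, table a.+2 <= i -> mm s i = 0].

Lemma tables_setr a t r v s : tables a t s -> 8 < r < 23 -> tables a t (setr s r v).
Proof.
case=> En [utE FE GE] F G Z r8; split=> //; first by apply: env_setr => //; lia.
by split; rewrite /= ifN //; lia.
Qed.

Lemma tables_pass a t j k s : tables a t s -> rg s r_j = j -> rg s r_k = k ->
  a < n -> j <= m -> k <= m ->
  tables a (fun Y => t Y + hits good a j k (mset J Y)) (sem w pass s).
Proof.
case=> En [utE FE GE] F G Z jE kE an jm km.
have G1 Y : Y < M -> mm s (table a.+1 + Y) <= 1 by move=> YM; rewrite G // leq_b1.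
have P := pass_ok En jE kE utE FE GE an jm km F G1.
have tge := table_ge a; have tS := tableS a; have tSS := tableS a.+1.
have M0 := M_gt0.
split.
- apply: env_sem => // [r|i ib]; first by rewrite /=; lia.
  by rewrite P ?ifF //; lia.
- by rewrite !sem_frame.
- by move=> Y YM; rewrite P ?ifF ?F //; lia.
- move=> Y YM; rewrite P ?ifT ?addKn ?G //; [|lia|lia].
  by rewrite !addn_eq0; case: (t Y).
- by move=> i ti; rewrite P ?ifF ?Z //; lia.
Qed.

Lemma tables_agent a s : tables a (fun=> 0) s -> a < n ->
  tables a (fun Y => reach good a.+1 (mset J Y))
    (sem w (For r_j r_m1 (For r_k r_m1 pass)) s).
Proof.
move=> T an; have [[_ [_ m1E _ _] _] _ _ _ _] := T.
have m1W : m.+1 < W by apply: bound_M m_ltM.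
pose I j s' := tables a (fun Y =>
  \sum_(j' < j) \sum_(k' < m.+1) hits good a j' k' (mset J Y)) s'.
have : I (rg s r_m1) (sem w (For r_j r_m1 (For r_k r_m1 pass)) s).
  apply: for_rule => //; first by rewrite m1E.
    apply: tables_setr => //; case: T => En R F G Z; split=> // Y YM.
    by rewrite G // big_ord0.
  rewrite m1E => j s1 jm jE fr1 T1; apply: tables_setr => //.
  have [[_ [_ m1E1 _ _] _] _ _ _ _] := T1.
  pose I' k s' := tables a (fun Y =>
    \sum_(j' < j) \sum_(k' < m.+1) hits good a j' k' (mset J Y) +
    \sum_(k' < k) hits good a j k' (mset J Y)) s'.
  have : I' (rg s1 r_m1) (sem w (For r_k r_m1 pass) s1).
    apply: for_rule => //; first by rewrite m1E1.
      apply: tables_setr => //; case: T1 => En R F G Z; split=> // Y YM.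
      by rewrite G // big_ord0 addn0.
    rewrite m1E1 => k s2 km kE fr2 T2; apply: tables_setr => //.
    have := tables_pass T2 (etrans (fr2 r_j isT isT) jE) kE an jm km.
    case=> En R F G Z; split=> // Y YM.
    by rewrite G // big_ord_recr addnA.
  rewrite m1E1; case=> En R F G Z; split=> // Y YM.
  by rewrite G // [in RHS]big_ord_recr.
rewrite m1E; case=> En R F G Z; split=> // Y YM.
by rewrite G // reachS; case: (_ != 0).
Qed.

Lemma main_ok s : tables 0 (fun=> 0) s ->
  (rg (sem w main s) r_res != 0) <-> exists T, reach good n T.
Proof.
move=> T; rewrite /main !semC !semA.
have [[[nE _ _ _] _ _] _ _ _ _] := T.
set c := For r_a _ _; set d := For r_Y _ _.
have nW : n < W.
  apply: leq_trans (ltnW table_W); rewrite /table.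
  by apply: leq_trans (leq_pmulr n.+1 M_gt0) (leq_addl _ _).
pose I a s' := tables a (fun=> 0) s'.
have : I (rg s r_n) (sem w c s).
  apply: for_rule => //.
  - by rewrite nE.
  rewrite nE => a s1 an aE fr T1; apply: tables_setr => //.
  rewrite !semC !semA.
  have := tables_agent T1 an; set s2 := sem w _ s1.
  case=> En [utE FE GE] F G Z.
  have tS := tableS a; have tSS := tableS a.+1; have tSSS := tableS a.+2.
  have M0 := M_gt0.
  have [[_ mE _ ME] _ _] := En.
  have utE' : eval w (setr (setr s2 r_F (eval w s2 (Var r_G))) r_G
      (eval w (setr s2 r_F (eval w s2 (Var r_G))) (Var r_G +' Var r_M)))
      (Var r_ut +' Var r_m) = 3 + a.+1 * m.
    rewrite eval_small //= utE mE -addnA [_ + m]addnC -mulSn //.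
    have h : a.+1 * m <= n * m by rewrite leq_mul2r an orbT.
    by have := M_leW; rewrite /base; lia.
  have GE' : eval w (setr s2 r_F (eval w s2 (Var r_G))) (Var r_G +' Var r_M) =
      table a.+2.
    rewrite eval_small //= GE ME -tableS //.
    apply: leq_ltn_trans table_W; rewrite /table leq_add2l leq_mul2r ltnS an orbT //.
  rewrite utE' GE'; split.
  - by do 3!apply: env_setr => //.
  - by split.
  - by move=> Y YM; apply: etrans (G Y YM) _; rewrite eqb0 negbK.
  - by move=> Y YM; rewrite /= Z //; lia.
  - by move=> i ti; rewrite /= Z //; lia.
rewrite nE; set s1 := sem w c s.
case=> En [utE FE GE] F G Z.
have [[_ _ _ ME] _ _] := En.
set s2 := setr s1 _ _.
have Wb (b b' : bool) : b + b' < W by have := W_gt3; case: b; case: b'; lia.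
pose I' k s' := rg s' r_res = (\sum_(Y < k) reach good n (mset J Y) != 0) /\
  mm s' = mm s1.
have : I' (rg s2 r_M) (sem w d s2).
  apply: for_rule => //.
  - by rewrite /= ME; apply: bound_M.
  - by rewrite /I' /= big_ord0 /eval mod0n.
  rewrite /= ME => k s3 kM kE fr [resE memE]; rewrite semA.
  have FE3 : rg s3 r_F = table n by rewrite fr.
  have addr : eval w s3 (Var r_F +' Var r_Y) = table n + k.
    by rewrite eval_small //= FE3 kE // table_ltW.
  have val : eval w s3 (Var r_res +' Mem (Var r_F +' Var r_Y)) =
      (\sum_(Y < k) reach good n (mset J Y) != 0) + reach good n (mset J k).
    by rewrite eval_small //= evalM addr resE memE F // Wb.
  split=> //=; rewrite eval_nz ?val ?W_gt1 ?Wb //.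
  by rewrite big_ord_recr /= !addn_eq0 eqb0 negbK.
rewrite /= ME => -[-> _].
rewrite eqb0 negbK sum_nat_eq0 negb_forall; split.
  by case/existsP=> Y; rewrite /= eqb0 negbK => ?; exists (mset J Y).
case=> S; have [Y YM <-] := mset_surj S => rY.
by apply/existsP; exists (Ordinal YM); rewrite /= rY.
Qed.

Hypothesis inp_zero : forall i, base <= i -> inp i = 0.

Lemma setup_ok s : rg s r_n = n -> rg s r_m = m -> rg s r_eta = eta ->
  mm s =1 inp -> tables 0 (fun=> 0) (sem w setup s).
Proof.
move=> nE mE etaE mmE.
have W1 := W_gt1; have MW := M_leW; have tW := table_leW (leq0n n).
have t0 : base + M + M = table 0 by rewrite /table addn0.
have mW : m.+1 < W by apply: bound_M m_ltM.
rewrite /setup semC semA.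
set s0 := setr s _ _; set c := For r_b _ _.
rewrite semC; set s1 := sem w c s0.
have M1 : rg s1 r_M = M.
  pose I k s' := rg s' r_M = 2 ^ k.
  have : I (rg s0 r_m) s1.
    apply: for_rule => //.
    - by rewrite /= mE; exact: ltnW.
    - by rewrite /I /= /eval expn0 modn_small.
    rewrite /= mE => k s' km _ _; rewrite /I semA /= => pE.
    rewrite eval_small //= pE mulnC -expnS //.
    by apply: bound_M; rewrite leq_exp2l.
  by rewrite /= mE.
have fr1 r : r != r_M -> r != r_b -> rg s1 r = rg s r.
  move=> /negbTE h1 /negbTE h2; rewrite /s1 sem_frame /=; first by rewrite h1.
  by rewrite h1 h2.
have mm1 : mm s1 = mm s by rewrite /s1 sem_nosto.
move: s1 M1 fr1 mm1 => s1 M1 fr1 mm1.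
rewrite semC semA (_ : eval w s1 _ = 3 + n * m); last first.
  by rewrite eval_small /= ?fr1 ?nE ?mE //; move: MW; rewrite /base; lia.
set s2 := setr s1 _ _.
rewrite semC semA (_ : eval w s2 _ = base); last first.
  by rewrite eval_small /= ?fr1 ?mE // -/base; lia.
set s3 := setr s2 _ _.
rewrite semC semA (_ : eval w s3 _ = m.+1); last first.
  by rewrite eval_small /= ?fr1 ?mE ?addn1.
set s4 := setr s3 _ _.
rewrite semC semA (_ : eval w s4 _ = base + M); last first.
  by rewrite eval_small /= ?M1 //; lia.
set s5 := setr s4 _ _.
rewrite semC semA (_ : eval w s5 _ = table 0); last first.
  by rewrite eval_small /= ?M1 ?t0 //; lia.
set s6 := setr s5 _ _.
rewrite semC semA (_ : eval w s6 _ = table 1); last first.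
  by rewrite eval_small /= ?M1 ?tableS //; lia.
set s7 := setr s6 _ _.
rewrite semC semA (_ : eval w s7 _ = 3); last first.
  by rewrite /eval modn_small // W_gt3.
rewrite semS.
set s8 := setr s7 _ _; rewrite (_ : eval w s8 (Cst 1) = 1); last first.
  by rewrite /eval modn_small.
have M0 := M_gt0; have t1 := tableS 0.
have m9 i : mm (setm s8 (table 0) 1) i = if i == table 0 then 1 else inp i.
  by rewrite /= mm1 mmE.
split.
- split.
  + by split; rewrite /= ?M1 ?fr1.
  + by split; rewrite /= ?fr1.
  + by move=> i ib; rewrite m9 ifN //; lia.
- by split.
(* Below [M] masks and sets correspond one to one, so 0 is the only mask of the empty set. *)
- move=> Y YM; rewrite m9 /= -(mset0 J) (inj_in_eq (D := [pred Y | Y < M])) ?inE //.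
    by rewrite -[X in _ == X]addn0 eqn_add2l; case: eqP => // _; rewrite inp_zero //; lia.
  by move=> x y; rewrite !inE; exact: mset_inj.
- move=> Y YM; rewrite m9 ifN ?inp_zero //; lia.
- move=> i ti; rewrite m9 ifN ?inp_zero //; have := tableS 1; lia.
Qed.
End Correctness.

(** * Running time *)

(* The cost is at most [cost_coef * A ^ cost_exp * t ^ cost_deg], if the
   register holding [2 ^ m] is at most [A] and all other loop bounds are at most
   [2 * t]. *)
Fixpoint cost_coef (c : cmd) : nat :=
  match c with
  | Asg r e => size (casg r e)
  | Sto e1 e2 => size (csto e1 e2)
  | Seq c1 c2 => cost_coef c1 + cost_coef c2
  | For _ _ c => 2 * (cost_coef c + 8) + 5
  end.

Fixpoint cost_exp (c : cmd) : nat :=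
  match c with
  | Seq c1 c2 => maxn (cost_exp c1) (cost_exp c2)
  | For _ b c => (b == 4) + cost_exp c
  | _ => 0
  end.

Fixpoint cost_deg (c : cmd) : nat :=
  match c with
  | Seq c1 c2 => maxn (cost_deg c1) (cost_deg c2)
  | For _ b c => (b != 4) + cost_deg c
  | _ => 0
  end.

(** The factor 2 accommodates the bound [m.+1], which can exceed [n + m] but is at most twice that
    when [n + m] is positive. *)
Lemma cost_le N A t c : 0 < A -> 0 < t ->
  (forall b, b \in loop_bounds c -> N b <= if b == 4 then A else 2 * t) ->
  cost N c <= cost_coef c * (A ^ cost_exp c * t ^ cost_deg c).
Proof.
move=> A0 t0; elim: c => [r e|e1 e2|c1 IH1 c2 IH2|i b c IH] Nb /=.
- by rewrite muln1.
- by rewrite muln1.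
- rewrite mulnDl leq_add //.
    apply: leq_trans (IH1 _) _ => [b hb|]; first by rewrite Nb // mem_cat hb.
    by rewrite leq_mul2l leq_mul ?orbT // leq_pexp2l // leq_maxl.
  apply: leq_trans (IH2 _) _ => [b hb|]; first by rewrite Nb // mem_cat hb orbT.
  by rewrite leq_mul2l leq_mul ?orbT // leq_pexp2l // leq_maxr.
have {}IH := IH (fun b' h => Nb b' (mem_behead (s := b :: _) h)).
have Nb' : N b <= 2 * (A ^ (b == 4) * t ^ (b != 4)).
  have := Nb b (mem_head _ _); case: (b == 4); rewrite ?expn1 ?expn0; lia.
set x := A ^ cost_exp c * t ^ cost_deg c in IH.
set y := A ^ (b == 4) * t ^ (b != 4) in Nb'.
have -> : A ^ ((b == 4) + cost_exp c) * t ^ ((b != 4) + cost_deg c) = y * x.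
  by rewrite !expnD mulnACA.
have x0 : 0 < x by rewrite muln_gt0 !expn_gt0 A0 t0.
have y0 : 0 < y by rewrite muln_gt0 !expn_gt0 A0 t0.
(* The additive constants 8 and 5 are absorbed because [x] and [y] are positive. *)
apply: leq_trans (_ : 2 * y * ((cost_coef c + 8) * x) + 5 * (y * x) <= _).
  apply: leq_add; last by rewrite -[leqLHS]muln1 leq_mul2l muln_gt0 y0 x0.
  by apply: leq_mul => //; rewrite mulnDl leq_add // -[leqLHS]muln1 leq_mul2l x0.
by rewrite [leqRHS]mulnDl leq_add2r mulnACA mulnA.
Qed.

(** * Reading the input *)

Lemma nth_pairs (A B : Type) (f : A -> B -> nat) x0 y0 s t i j :
  i < size s -> j < size t ->
  nth 0 [seq f x y | x <- s, y <- t] (i * size t + j) = f (nth x0 s i) (nth y0 t j).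
Proof.
elim: s i => [|x s IH] [|i] //= si tj; rewrite nth_cat size_map.
  by rewrite tj (nth_map y0).
by rewrite mulSn -addnA ltnNge leq_addr /= addKn IH.
Qed.

Section Instance.
Variables (X : cffa).
Local Notation n := #|agent X|.
Local Notation m := #|job X|.
Local Notation inp := (nth 0 (encode X)).

Lemma encode_util (a : agent X) (x : job X) :
  inp (3 + enum_rank a * m + enum_rank x) = utility a x.
Proof.
rewrite /encode /= nth_cat size_allpairs -!cardE.
rewrite index_lt ?ltn_ord // [X in _ * X]cardE (nth_pairs _ a x) -?cardE //.
by rewrite !nth_enum_rank.
Qed.

Lemma encode_conflict (x y : job X) :
  inp (3 + n * m + enum_rank x * m + enum_rank y) = conflict x y.
Proof.
rewrite /encode /= nth_cat size_allpairs -!cardE -addnA ltnNge leq_addr /= addKn.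
rewrite [X in _ * X]cardE (nth_pairs _ x y) -?cardE //.
by rewrite !nth_enum_rank.
Qed.

Lemma size_encode : size (encode X) = base (job X) n.
Proof.
by rewrite /encode /= size_cat !size_allpairs -!cardE /base -addnA.
Qed.

(** Reading the utilities off the input makes them total in a natural number [a] without a default
    agent, which need not exist. *)
Definition util (a : nat) (x : job X) : nat := inp (3 + a * m + enum_rank x).

Lemma good_rank (a : agent X) (S : {set job X}) :
  good (eta X) util (@conflict X) (enum_rank a) S <->
  independent (@conflict X) S /\ eta X <= \sum_(x in S) utility a x.
Proof.
rewrite /good; have -> : \sum_(x in S) util (enum_rank a) x = \sum_(x in S) utility a x.
  by apply: eq_bigr => x _; rewrite /util encode_util.
split=> [/andP[h ->]|[h ->]]; last first.
  rewrite andbT big1 // => x xS; rewrite big1 // => y yS.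
  by apply/eqP; rewrite eqb0; apply: h.
split=> // x y xS yS; move: h; rewrite sum_nat_eq0 => /forallP/(_ x); rewrite xS.
by rewrite sum_nat_eq0 => /forallP/(_ y); rewrite yS /= eqb0.
Qed.

Lemma reach_yes :
  (exists T, reach (good (eta X) util (@conflict X)) n T) <-> yes_instance X.
Proof.
split.
  case=> T /reachP[phi [gp dp _]].
  exists (fun a => phi (enum_rank a)); split; [|split].
  - by move=> a; have /good_rank[] := gp _ (ltn_ord (enum_rank a)).
  - by move=> a; have /good_rank[] := gp _ (ltn_ord (enum_rank a)).
  move=> a b; rewrite -(inj_eq enum_rank_inj) -(inj_eq val_inj) neq_ltn /=.
  case/orP=> h; first by apply: dp; rewrite h ltn_ord.
  by rewrite disjoint_sym; apply: dp; rewrite h ltn_ord.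
case=> phi [ind [ut dj]].
pose psi i := if insub i is Some k then phi (enum_val (k : 'I_n)) else set0.
exists (\bigcup_(i < n) psi i); apply/reachP; exists psi; split=> //.
  move=> i ia; rewrite /psi insubT.
  have := good_rank (enum_val (Ordinal ia)) (phi (enum_val (Ordinal ia))).
  by rewrite enum_valK /= => -[_]; apply; split; [exact: ind|exact: ut].
move=> i j /andP[ij ja]; have ia := ltn_trans ij ja.
rewrite /psi !insubT; apply: dj; rewrite (inj_eq enum_val_inj) -(inj_eq val_inj) /=.
by rewrite ltn_eqF.
Qed.

Lemma encode_lt i : inp i < 2 ^ input_bits X.
Proof.
have [si|si] := ltnP i (size (encode X)); last by rewrite nth_default // expn_gt0.
apply: leq_trans (up_logP _ (isT : 1 < 2)) _; rewrite leq_exp2l //.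
by rewrite /input_bits (big_nth 0) big_mkord (bigmax_sup (Ordinal si)).
Qed.

End Instance.

(** * Word length and the complete run *)

Section Run.
Variables (X : cffa) (w : nat).
Local Notation n := #|agent X|.
Local Notation m := #|job X|.
Local Notation inp := (nth 0 (encode X)).

Hypothesis w_large : 8 * (m + input_bits X) <= w.

Local Notation L := (2 ^ (m + input_bits X)).

Lemma bits_gt0 : 0 < input_bits X.
Proof.
have := encode_lt X 2; have := eta_gt0 X; rewrite /=.
by case: (input_bits X) => // h; rewrite expn0 ltnS leqNgt h.
Qed.

Lemma L_gt1 : 1 < L.
Proof. by rewrite -{1}(expn0 2) ltn_exp2l // addn_gt0 bits_gt0 orbT. Qed.

(** This is where the 8 in the word length comes from. The numbers [n], [m], [eta], the utilities
    and [2 ^ m] are all below [L], so each quantity of the program is at most a small multiple of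
    [L * L]; as [L] is at least 2, six further factors [L] leave room for the constant 64. *)
Lemma wordP : 64 * (L * L) <= 2 ^ w.
Proof.
apply: (@leq_trans (L ^ 8)); last by rewrite -expnM leq_exp2l // mulnC.
have h : 4 <= L * L by have := L_gt1; nia.
have -> : L ^ 8 = (L * L) * (L * L) * (L * L) * (L * L) by rewrite !expnS expn0 muln1 !mulnA.
by rewrite leq_mul2r (leq_mul (leq_mul h h) h) orbT.
Qed.

Lemma inp_ltL i : inp i < L.
Proof. by apply: leq_trans (encode_lt X i) _; rewrite leq_exp2l // leq_addl. Qed.

Lemma pow_leL : 2 * 2 ^ m <= L.
Proof. by rewrite -expnS leq_exp2l // -addn1 leq_add2l bits_gt0. Qed.

Lemma table_fits : table (job X) n n.+1 < 2 ^ w.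
Proof.
have n1 := inp_ltL 0; have m1 := inp_ltL 1; rewrite /= in n1 m1.
have M1 := pow_leL; have L1 := L_gt1.
apply: leq_trans wordP; rewrite /table /base.
have h1 : n * m <= L * L by rewrite leq_mul // ltnW.
have h2 : m * m <= L * L by rewrite leq_mul // ltnW.
have h3 : n.+1 * 2 ^ m <= L * L by rewrite leq_mul //; lia.
have h4 : L * 2 <= L * L by rewrite leq_mul2l L1 orbT.
lia.
Qed.

Lemma prod_fits : 2 ^ m * 2 ^ m + 1 < 2 ^ w.
Proof.
have M1 := pow_leL; have L1 := L_gt1; apply: leq_trans wordP.
have h : 2 ^ m * 2 ^ m <= L * L by rewrite leq_mul //; lia.
have h4 : L * 2 <= L * L by rewrite leq_mul2l L1 orbT.
lia.
Qed.

Lemma sum_fits a : a < n -> \sum_x @util X a x + 1 < 2 ^ w.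
Proof.
move=> _; have L1 := L_gt1; have m1 := inp_ltL 1; rewrite /= in m1.
apply: leq_trans wordP.
have h : \sum_(x : job X) @util X a x <= L * L.
  apply: (@leq_trans (\sum_(x in job X) L)).
    by apply: leq_sum => x _; exact: ltnW (inp_ltL _).
  by rewrite sum_nat_const leq_mul // ltnW.
have h4 : L * 2 <= L * L by rewrite leq_mul2l L1 orbT.
lia.
Qed.

Lemma small_fits x : x <= L -> x < 2 ^ w.
Proof.
move=> xL; have L1 := L_gt1; apply: leq_trans wordP.
have h4 : L * 2 <= L * L by rewrite leq_mul2l L1 orbT.
lia.
Qed.

Definition bounds (r : nat) : nat := nth 0 [:: 0; n; m; 0; 2 ^ m; 0; m.+1] r.

Definition steps : nat :=
  cost bounds main + (cost bounds setup + cost bounds read_sizes).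

Lemma run_ok :
  halted cffa_program (run w cffa_program (encode X) steps) /\
  (accepting (run w cffa_program (encode X) steps) <-> yes_instance X).
Proof.
have W2 : 2 < 2 ^ w by have := wordP; have := L_gt1; nia.
have w0 : 0 < w by case: (w) W2.
rewrite /run /steps (iterD (cost bounds main)) (iterD (cost bounds setup)).
set P := cffa_program; set s0 := Store (fun=> 0) inp.
have [cd0 cd12] : code_at P 0 (ccmd 0 read_sizes) /\
    code_at P (csize read_sizes) (ccmd (csize read_sizes) setup ++
      ccmd (csize read_sizes + csize setup) main).
  rewrite -{2}(size_ccmd 0 read_sizes) -[size _]add0n.
  by apply: code_at_cat => k _; rewrite add0n.
have [cd1 cd2] := code_at_cat cd12; rewrite size_ccmd in cd2.
have [ag0 pc0] := @ccmd_ok w bounds P read_sizes 0 s0 (init (encode X))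
  w0 isT (fun b (h : b \in [::]) => False_ind _ (notF h)) cd0 erefl
  (conj (fun r _ => erefl) (fun x => erefl)).
rewrite add0n in pc0; set st0 := iter _ _ _ in ag0 pc0 *.
have [n1 m1 e1] : [/\ rg (sem w read_sizes s0) 1 = n,
    rg (sem w read_sizes s0) 2 = m & rg (sem w read_sizes s0) 3 = eta X].
  by rewrite /read_sizes !semC !semA /eval /= mod0n !modn_small ?(ltnW W2).
have mm1 : mm (sem w read_sizes s0) =1 inp by move=> i; rewrite sem_nosto.
move: (sem w read_sizes s0) ag0 n1 m1 e1 mm1 => s1 ag0 n1 m1 e1 mm1.
have mW : m.+1 < 2 ^ w.
  by apply: small_fits; have := inp_ltL 1.
have fx1 : fixed_bounds w bounds setup s1.
  by move=> b; rewrite inE => /eqP->; rewrite m1; split=> //; apply: ltnW.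
have [ag1 pc1] := ccmd_ok w0 (isT : wf setup) fx1 cd1 pc0 ag0.
set st1 := iter _ _ _ in ag1 pc1 *.
have etaW : eta X < 2 ^ w by apply: small_fits; rewrite ltnW // (inp_ltL 2).
have T := @setup_ok (job X) w n (eta X) inp (@util X) (@conflict X)
  table_fits prod_fits etaW _ s1 n1 m1 e1 mm1.
have {}T : tables n (eta X) inp (@util X) (@conflict X) 0 (fun=> 0) (sem w setup s1).
  by apply: T => i ib; rewrite nth_default // size_encode.
have R := main_ok table_fits prod_fits etaW sum_fits (fun a x _ => erefl)
  (@encode_conflict X) T.
have fx2 : fixed_bounds w bounds main (sem w setup s1).
  have [[[nE mE _ ME] [_ m1E _ _] _] _ _ _ _] := T.
  have /allP loops : all (fun b => b \in [:: 1; 2; 4; 6]) (loop_bounds main) by [].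
  move=> b /loops; rewrite !inE => /or4P[]/eqP->; split=> //.
  - exact: small_fits (ltnW (inp_ltL 0)).
  - exact: ltnW.
  - suff h : 2 ^ m <= L by exact: (small_fits h).
    exact: leq_trans (leq_pmull _ _) pow_leL.
have [ag2 pc2] := ccmd_ok w0 (isT : wf main) fx2 cd2 pc1 ag1.
set st2 := iter _ _ _ in ag2 pc2 *; split.
  suff -> : halted P st2 = (size P <= csize read_sizes + csize setup + csize main).
    rewrite (size_cat (ccmd 0 read_sizes)) (size_cat (ccmd (csize read_sizes) setup)).
    by rewrite (size_ccmd 0 read_sizes) (size_ccmd _ setup) (size_ccmd _ main) addnA.
  by rewrite /halted pc2.
by rewrite /accepting (proj1 ag2) // R; exact: reach_yes.
Qed.
End Run.

Definition step_coef : nat :=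
  cost_coef main + (cost_coef setup + cost_coef read_sizes).

Lemma steps_le X : 0 < #|agent X| + #|job X| ->
  steps X <= step_coef *
    (2 ^ #|job X| * (#|agent X| + #|job X|) ^ cost_deg main).
Proof.
set n := #|agent X|; set m := #|job X|; set t := n + m => t0.
have M0 : 0 < 2 ^ m by rewrite expn_gt0.
(* Exponent at most 1 means that no loop over all masks is nested in another one. For the three
   commands both conditions are settled by evaluation. *)
have bnd c : cost_exp c <= 1 -> cost_deg c <= cost_deg main ->
    cost (bounds X) c <= cost_coef c * (2 ^ m * t ^ cost_deg main).
  move=> e1 d1; apply: leq_trans (cost_le (A := 2 ^ m) (t := t) M0 t0 _) _.
    move=> b _; rewrite /bounds -/n -/m.
    by do 7?[case: b => [|b] //=]; rewrite ?nth_nil //; rewrite /t in t0 *; lia.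
  rewrite leq_mul2l leq_mul ?orbT //; last by rewrite leq_pexp2l.
  by rewrite -[leqRHS]expn1 leq_pexp2l.
rewrite /steps /step_coef (mulnDl (cost_coef main)) (mulnDl (cost_coef setup)).
by apply: leq_add; [|apply: leq_add]; apply: bnd.
Qed.

Theorem theorem9 :
  exists (P : program) (K C c : nat),
    0 < K /\ decides_cffa P K (fun n m => C * (2 ^ m * (n + m) ^ c)).
Proof.
exists cffa_program, 8, step_coef, (cost_deg main); split=> // X w n m wK.
have [hl ac] := run_ok wK.
by exists (steps X); split=> //; exact: steps_le.
Qed.
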